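(* Let $(A,\mathfrak m)$ be a regular local ring and let $I$ be a proper ideal of $A$. Set $m=\mu(I)$ and $g=\operatorname{grade}(I)$. Set $c=\max\{\operatorname{cmd}H_i(I): 0\le i<m-g\}$. Then $$\operatorname{cmd}H_{m-g}(I)\le\max\{0,c-2\}.$$
   Context: $\mu(I)$ is the minimal number of generators of $I$; $\operatorname{grade}(I)$ is the length of a maximal $A$-regular sequence in $I$. $H_i(I)$ is the $i$-th Koszul homology module (coefficients in $A$) of a minimal generating set of $I$ (independent, up to isomorphism, of the choice). $\operatorname{cmd}E=\dim E-\operatorname{depth}E$ is the Cohen-Macaulay defect. If $m=g$ the maximum over the empty set is taken to be $0$. *)

(* Defs.v *)
From HB Require Import structures.
From mathcomp Require Import all_boot all_order all_algebra.
From mathcomp Require Import ring_quotient generic_quotient.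
From mathcomp Require Import boolp classical_sets.

Set Implicit Arguments.
Unset Strict Implicit.
Unset Printing Implicit Defensive.

Import Order.TTheory GRing.Theory Num.Theory.
Local Open Scope ring_scope.

(* Ideals of A are boolean predicates {pred A}; in the presence of the axioms
   of boolp this is no restriction. The library's [idealr_closed J] says that J
   is a PROPER ideal, and [prime_idealr_closed] is only the multiplicative part
   of primality. *)

Section Ideals.
Variable A : comNzRingType.
Implicit Types J M P : {pred A}.

Definition generates (n : nat) (x : 'I_n -> A) J : Prop :=
  forall a, a \in J <-> exists u : 'I_n -> A, a = \sum_(i < n) u i * x i.

(* mu(J); the value is 0 if J is not finitely generated *)
Definition mu J : nat :=
  xget 0%N [set n | (exists x : 'I_n -> A, generates x J) /\
     forall k, (exists x : 'I_k -> A, generates x J) -> (n <= k)%N]%classic.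

(* the unit ideal, excluded by [idealr_closed], is generated by 1 *)
Definition noetherian : Prop :=
  forall J, idealr_closed J -> exists n, exists x : 'I_n -> A, generates x J.

Definition maximal_ideal M : Prop :=
  idealr_closed M /\
  forall J, idealr_closed J -> {subset M <= J} -> {subset J <= M}.

Definition local_ring M : Prop :=
  maximal_ideal M /\ forall N, maximal_ideal N -> N =i M.

Definition prime_ideal P : Prop := idealr_closed P /\ prime_idealr_closed P.

(* p 0 < p 1 < ... < p n; the values p i for i > n are irrelevant *)
Definition prime_chain (n : nat) (p : nat -> {pred A}) : Prop :=
  (forall i, (i <= n)%N -> prime_ideal (p i)) /\
  (forall i, (i < n)%N ->
     {subset p i <= p i.+1} /\ ~ {subset p i.+1 <= p i}).

Definition chain_above J (n : nat) : Prop :=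
  exists p, prime_chain n p /\ {subset J <= p 0%N}.

(* The Krull dimension of A/J, primes of A/J being the primes of A containing
   J; the value is 0 if there is no longest chain. *)
Definition krull_dim J : nat :=
  xget 0%N [set n | chain_above J n /\
     forall k, chain_above J k -> (k <= n)%N]%classic.

Definition regular_local_ring M : Prop :=
  [/\ noetherian, local_ring M & mu M = krull_dim (pred1 0)].

End Ideals.

Section Modules.
Variables (A : comNzRingType) (E : lmodType A).
Implicit Types (s : seq A) (J M : {pred A}).

(* the submodule (s_1, ..., s_k)E *)
Definition seq_mul s (e : E) : Prop :=
  exists u : nat -> E, e = \sum_(i < size s) s`_i *: u i.

Definition regular_seq s : Prop :=
  (exists e, ~ seq_mul s e) /\
  forall i, (i < size s)%N ->
    forall e, seq_mul (take i s) (s`_i *: e) -> seq_mul (take i s) e.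

Definition maximal_regular_seq J s : Prop :=
  [/\ {subset s <= J}, regular_seq s &
      forall a, a \in J -> ~ regular_seq (rcons s a)].

(* The common length of the maximal E-regular sequences in J (all of the same
   length when A is Noetherian and E is finitely generated with JE <> E). *)
Definition grade J : nat :=
  xget 0%N [set n | exists2 s, maximal_regular_seq J s & size s = n]%classic.

Definition annihilator : {pred A} :=
  [pred a | `[< forall e : E, a *: e = 0 >]].

Definition module_dim : nat := krull_dim annihilator.

(* In [depth M] and [cmd M], M is the maximal ideal of the local ring A. *)
Definition depth M : nat := grade M.

Definition cmd M : int := (module_dim%:Z - (depth M)%:Z)%R.

End Modules.

Section SubModule.
Variables (A : comNzRingType) (V : lmodType A) (W : submodClosed V).

Record submod := Submod { submod_val : V; _ : submod_val \in W }.

HB.instance Definition _ := [isSub for submod_val].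
HB.instance Definition _ := [Choice of submod by <:].
HB.instance Definition _ := [SubChoice_isSubLmodule of submod by <:].

End SubModule.

Section QuotientModule.
Variables (A : comNzRingType) (V : lmodType A) (W : submodClosed V).
Local Open Scope quotient_scope.

(* W again; submodClosed lives over semirings and does not record the
   stability under opposite that Quotient.quot requires. *)
Definition submod_pred : {pred V} := W.

Lemma submod_pred_zmod_closed : zmod_closed submod_pred.
Proof. exact: (GRing.submod_closedB (submodClosedP W)). Qed.
HB.instance Definition _ :=
  GRing.isZmodClosed.Build V submod_pred submod_pred_zmod_closed.

Local Notation Q := (Quotient.quot submod_pred).

Definition quot_scale (a : A) (x : Q) : Q := \pi_Q (a *: repr x).

Lemma pi_scale a v : \pi_Q (a *: v) = quot_scale a (\pi_Q v).
Proof.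
apply/eqP; rewrite -Quotient.idealrBE -scalerBr; apply: (@rpredZ _ _ W).
have: v - repr (\pi_Q v) \in submod_pred; last by [].
by rewrite Quotient.idealrBE reprK eqxx.
Qed.

Lemma quot_scaleA a b x : quot_scale a (quot_scale b x) = quot_scale (a * b) x.
Proof. by rewrite -[x]reprK -(pi_scale b) -!pi_scale scalerA. Qed.

Lemma quot_scale1 : left_id 1 quot_scale.
Proof. by move=> x; rewrite -[x]reprK -pi_scale scale1r. Qed.

Lemma quot_scaleDr : right_distributive quot_scale +%R.
Proof.
move=> a x y; rewrite -[x]reprK -[y]reprK -!pi_scale.
by rewrite -!raddfD /= -pi_scale scalerDr.
Qed.

Lemma quot_scaleDl x : {morph quot_scale^~ x : a b / a + b}.
Proof. by move=> a b; rewrite -[x]reprK -!pi_scale scalerDl raddfD. Qed.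

HB.instance Definition _ := GRing.Zmodule_isLmodule.Build A Q
  quot_scaleA quot_scale1 quot_scaleDr quot_scaleDl.

Definition quotmod : lmodType A := Q.

End QuotientModule.

Section Koszul.
Variables (A : comNzRingType) (n : nat) (x : 'I_n -> A).

(* The exterior algebra of A^n: f stands for \sum_S f S * e_S, where
   e_S = e_{j_1} /\ ... /\ e_{j_i} for S = {j_1 < ... < j_i}. *)
Definition koszul : Type := {ffun {set 'I_n} -> A^o}.
HB.instance Definition _ := GRing.Lmodule.on koszul.

Definition homogeneous (i : nat) (f : koszul) : bool :=
  [forall S : {set 'I_n}, (f S != 0) ==> (#|S| == i)].

Definition koszul_sign (j : 'I_n) (S : {set 'I_n}) : A :=
  (-1) ^+ #|[set k in S | (k < j)%N]|.

(* The differential d e_S = \sum_(j in S) koszul_sign j S * x_j * e_{S \ j},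
   read off at the coefficient of e_T: there S = j |: T with j \notin T, and
   koszul_sign j S = koszul_sign j T. *)
Definition koszul_d (f : koszul) : koszul :=
  [ffun T : {set 'I_n} =>
     \sum_(j | j \notin T) koszul_sign j T * x j * f (j |: T) : A^o].

Lemma koszul_d_is_linear : linear koszul_d.
Proof.
move=> a f g; apply/ffunP => T; rewrite !ffunE scaler_sumr -big_split /=.
apply: eq_bigr => j _; rewrite !ffunE mulrDr; congr (_ + _).
by rewrite /GRing.scale /= mulrCA.
Qed.
HB.instance Definition _ :=
  GRing.isLinear.Build A koszul koszul _ koszul_d koszul_d_is_linear.

Lemma koszul_sign_swap (T : {set 'I_n}) (j k : 'I_n) : j \notin T ->
  (j < k)%N ->
  koszul_sign j T * koszul_sign k (j |: T)
    = - (koszul_sign k T * koszul_sign j (k |: T)).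
Proof.
move=> jT jk; rewrite /koszul_sign.
have -> : [set l in k |: T | (l < j)%N] = [set l in T | (l < j)%N].
  apply/setP=> l; rewrite !inE; case: eqP => [->|//] /=.
  by rewrite ltnNge (ltnW jk) andbF.
have -> : [set l in j |: T | (l < k)%N] = j |: [set l in T | (l < k)%N].
  by apply/setP=> l; rewrite !inE; case: eqP => [->|//]; rewrite jk.
by rewrite cardsU1 inE (negPf jT) /= exprS mulN1r mulrN mulrC.
Qed.

Lemma koszul_dd f : koszul_d (koszul_d f) = 0.
Proof.
apply/ffunP=> T; rewrite !ffunE.
pose F j k := koszul_sign j T * x j *
  (koszul_sign k (j |: T) * x k * f (k |: (j |: T))).
have -> : \sum_(j | j \notin T) koszul_sign j T * x j * koszul_d f (j |: T)
  = \sum_(j | j \notin T) \sum_(k | k \notin j |: T) F j k.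
  by apply: eq_bigr => j _; rewrite ffunE mulr_sumr.
rewrite pair_big_dep /= (bigID (fun p : 'I_n * 'I_n => (p.1 < p.2)%N)) /=.
have swap_inj : injective (fun p : 'I_n * 'I_n => (p.2, p.1)).
  by move=> [? ?] [? ?] [-> ->].
rewrite [X in _ + X](reindex_inj swap_inj) /=.
rewrite [X in _ + X](eq_bigl (fun p : 'I_n * 'I_n =>
  (p.1 \notin T) && (p.2 \notin p.1 |: T) && (p.1 < p.2)%N)); last first.
  case=> j k /=; rewrite !inE !negb_or -leqNgt -!val_eqE /=.
  by case: (ltngtP k j) => //= _; rewrite ?andbF // !andbT andbC.
rewrite -big_split /= big1 // => -[j k] /= /andP[/andP[jT kjT] jk].
have FE a b : F a b =
    koszul_sign a T * koszul_sign b (a |: T) * (x a * x b * f (b |: (a |: T))).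
  by rewrite /F mulrA mulrACA [RHS]mulrA.
rewrite !FE (koszul_sign_swap jT jk) finset.setUCA [x k * x j]mulrC.
by rewrite mulNr addNr.
Qed.

Definition koszul_cycle (i : nat) : {pred koszul} :=
  [pred f | homogeneous i f && (koszul_d f == 0)].

Lemma homogeneousP i (f : koszul) :
  reflect (forall S, f S != 0 -> #|S| = i) (homogeneous i f).
Proof.
by apply: (iffP forallP) => h S; [move/implyP: (h S) => {}h /h/eqP |
   apply/implyP => /h/eqP].
Qed.

Lemma homogeneous_lin i a (f g : koszul) :
  homogeneous i f -> homogeneous i g -> homogeneous i (a *: f + g).
Proof.
move=> /homogeneousP hf /homogeneousP hg; apply/homogeneousP => S.
rewrite !ffunE; case: (eqVneq (f S) 0) => [->|/hf//].
by rewrite scaler0 add0r => /hg.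
Qed.

Lemma homogeneous0 i : homogeneous i 0.
Proof. by apply/homogeneousP => S; rewrite ffunE eqxx. Qed.

Lemma koszul_cycle_submod i : submod_closed (koszul_cycle i).
Proof.
split; first by rewrite inE homogeneous0 linear0 eqxx.
move=> a f g; rewrite !inE => /andP[hf /eqP df] /andP[hg /eqP dg].
by rewrite homogeneous_lin // koszul_d_is_linear df dg scaler0 addr0 eqxx.
Qed.
HB.instance Definition _ i := GRing.isSubmodClosed.Build A koszul
  (koszul_cycle i) (koszul_cycle_submod i).

Definition koszul_boundary (i : nat) : {pred submod (koszul_cycle i)} :=
  [pred z | `[< exists2 f, homogeneous i.+1 f & koszul_d f = val z >]].
Arguments koszul_boundary : clear implicits.

Lemma koszul_boundary_submod i : submod_closed (koszul_boundary i).
Proof.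
split.
  by apply/asboolP; exists 0; rewrite ?homogeneous0 // linear0.
move=> a y z /asboolP[f hf df] /asboolP[g hg dg]; apply/asboolP.
exists (a *: f + g); first exact: homogeneous_lin.
by rewrite koszul_d_is_linear df dg.
Qed.
HB.instance Definition _ i := GRing.isSubmodClosed.Build A
  (submod (koszul_cycle i)) (koszul_boundary i) (koszul_boundary_submod i).

Definition koszul_homology (i : nat) : lmodType A :=
  quotmod (koszul_boundary i).

End Koszul.

(* Main.v *)
(*
   Fix generators z of the maximal ideal. The depth of E is detected by the
   vanishing of the Koszul homology H_j(z; E) for j > |z| - depth E, which is
   stable along short exact sequences. Let d = dim A, y a maximal regular
   sequence in I, g = |y|, and let Z_i, B_i be the cycles and boundaries of the
   Koszul complex K of I.

   If all the H_i with i < m - g have depth >= k, then climbing along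
   0 -> B_i -> Z_i -> H_i -> 0 and 0 -> Z_{i+1} -> K_{i+1} -> B_i -> 0 from
   Z_0 = A gives depth Z_{m-g} >= min(d, k + 2). As K is exact above m - g, going
   down from B_m = 0 gives depth B_{m-g} >= d - g + 1. Hence
   depth H_{m-g} >= min(d - g, k + 2).

   It remains to see that H_0, ..., H_{m-g} all have dimension d - g. The upper
   bound holds because y kills them. For the lower bound take an associated prime
   P = (y : b) of A/y containing I: since A is Cohen-Macaulay there is a chain of
   primes of length d - g starting at P, and P contains the annihilator of H_i
   because otherwise, by rigidity of the Koszul complex at P, H_{m-g} would vanish
   at P, whereas H_{m-g} is isomorphic to (y : I)/y, in which b survives at P.
*)
From HB Require Import structures.
Require Import Defs.
From mathcomp Require Import all_boot all_order all_algebra.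
From mathcomp Require Import ring_quotient generic_quotient.
From mathcomp Require Import boolp classical_sets.
From mathcomp Require Import ring zify.

Set Implicit Arguments.
Unset Strict Implicit.
Unset Printing Implicit Defensive.

Import Order.TTheory GRing.Theory Num.Theory.
Local Open Scope ring_scope.

(** * Submodules and noetherian modules *)

(** The gain of 2 comes from two depth shifts in one climbing step: B_i is the kernel of Z_i -> H_i,
    which allows one more than depth H_i, and Z_{i+1} is the kernel of a map from the free module
    K_{i+1} onto B_i, which allows one more again. H_i limits the depth afresh at each step, so the
    bound min(d, k + 2) reproduces itself instead of growing with i. As the dimensions agree, a
    bound c on the defects becomes the bound k = d - g - c on depths. Regularity enters through
    chains of primes: mu(M) = dim A makes minimal generators z of M a regular sequence, so z both
    detects depth and gives depth A >= d. Localization at P is expressed elementwise, by multipliers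
    outside P; the Koszul arguments carry a multiplicative set S that covers this case and plain
    vanishing. They run on an iterated cone [kos E l], suited to induction on l and to coefficients
    in a module, and [kphi] identifies it with the exterior algebra. *)

Section Submodules.
Variable A : comNzRingType.
Implicit Types E U V W : lmodType A.

Definition subm E (N : E -> Prop) : Prop :=
  N 0 /\ forall a u v, N u -> N v -> N (a *: u + v).

Section SubmTheory.
Variables (E : lmodType A) (N : E -> Prop).
Hypothesis hN : subm N.

Lemma subm0 : N 0. Proof. by case: hN. Qed.

Lemma submD u v : N u -> N v -> N (u + v).
Proof. by move=> hu hv; rewrite -[u]scale1r; apply: (proj2 hN). Qed.

Lemma submZ a u : N u -> N (a *: u).
Proof. by move=> hu; rewrite -[_ *: _]addr0; apply: (proj2 hN) => //; exact: subm0. Qed.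

Lemma submN u : N u -> N (- u).
Proof. by rewrite -scaleN1r; exact: submZ. Qed.

Lemma submB u v : N u -> N v -> N (u - v).
Proof. by move=> hu /submN; exact: submD. Qed.

End SubmTheory.

Lemma subm_span E (N : E -> Prop) a :
  subm N -> subm (fun e => exists n f, N n /\ e = n + a *: f).
Proof.
move=> hN; split; first by exists 0, 0; rewrite scaler0 addr0; split=> //; exact: subm0.
move=> b u v [n [f [hn ->]]] [n' [f' [hn' ->]]].
exists (b *: n + n'), (b *: f + f'); split; first exact: (proj2 hN).
by rewrite !scalerDr !scalerA mulrC addrACA.
Qed.

Lemma subm_add1 E (N : E -> Prop) t :
  subm N -> subm (fun e => exists n b, N n /\ e = n + b *: t).
Proof.
move=> hN; split; first by exists 0, 0; rewrite scale0r addr0; split=> //; exact: subm0.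
move=> b u v [n [c [hn ->]]] [n' [c' [hn' ->]]].
exists (b *: n + n'), (b * c + c'); split; first exact: (proj2 hN).
by rewrite scalerDr scalerDl scalerA addrACA.
Qed.

Definition noeth_mod E : Prop :=
  forall F : (E -> Prop) -> Prop, (forall N, F N -> subm N) -> (exists N, F N) ->
  exists N, F N /\
    forall N', F N' -> (forall e, N e -> N' e) -> forall e, N' e -> N e.

Definition to_pred (P : A -> Prop) : {pred A} := [pred a | `[< P a >]].

Lemma prP (P : A -> Prop) a : reflect (P a) (a \in to_pred P).
Proof. exact: asboolP. Qed.

Lemma idealr_subm (J : {pred A}) :
  idealr_closed J -> @subm A^o (fun a => a \in J).
Proof. by case=> h0 _ h; split=> // a u v hu hv; exact: h. Qed.

Lemma subm_idealr (J : A -> Prop) : @subm A^o J -> ~ J 1 -> idealr_closed (to_pred J).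
Proof.
case=> h0 h h1; split; [exact/prP | by apply/negP => /prP |].
by move=> a u v /prP hu /prP hv; apply/prP/h.
Qed.

Section PrimeTheory.
Variable P : {pred A}.
Hypothesis hP : prime_ideal P.

Lemma prime_subm : @subm A^o (fun a => a \in P).
Proof. exact: idealr_subm (proj1 hP). Qed.

Lemma prime1 : 1 \notin P. Proof. by case: hP => -[]. Qed.

Lemma primeM u v : u \notin P -> v \notin P -> u * v \notin P.
Proof. by move=> hu hv; apply/negP => /(proj2 hP); rewrite (negPf hu) (negPf hv). Qed.

Lemma prime_absorb u v : v \in P -> u * v \in P.
Proof. exact: (@submZ A^o _ prime_subm u v). Qed.

Lemma primeX u n : u \notin P -> u ^+ n \notin P.
Proof.
by move=> hu; elim: n => [|n IH]; rewrite ?expr0 ?prime1 // exprS primeM.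
Qed.

Lemma primeB s a : s \notin P -> a \in P -> s - a \notin P.
Proof.
move=> hs ha; apply: contra hs => h; rewrite -[s](subrK a).
exact: (@submD A^o _ prime_subm).
Qed.

End PrimeTheory.

Lemma prime_intro (P : A -> Prop) : @subm A^o P -> ~ P 1 ->
  (forall u v, P (u * v) -> P u \/ P v) -> prime_ideal (to_pred P).
Proof.
move=> h h1 hM; split; first exact: subm_idealr.
by move=> u v /prP/hM[] h'; apply/orP; [left|right]; apply/prP.
Qed.

Section Noetherian.
Hypothesis hA : noetherian A.

(** A family without a maximal member yields, by choice, a strictly increasing sequence; its union
    is finitely generated, so one term already contains all the generators. *)
Lemma noeth_mod_ring : noeth_mod A^o.
Proof.
move=> F Fsub [N0 FN0]; apply: contrapT => hmax.
have step (X : {N | F N}) : {Y : {N | F N} | (forall e, sval X e -> sval Y e) /\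
   exists e, sval Y e /\ ~ sval X e}.
  case: X => N FN /=; apply/cid; apply: contrapT => hno; apply: hmax.
  exists N; split=> // N' FN' NN' e N'e; apply: contrapT => nNe.
  by apply: hno; exists (exist _ N' FN'); split=> //; exists e.
pose c k := iter k (fun X => sval (step X)) (exist _ N0 FN0).
have cS k : forall e, sval (c k) e -> sval (c k.+1) e.
  by move=> e; rewrite /c /=; case: (svalP (step (c k))) => h _; exact: h.
have cle k l : (k <= l)%N -> forall e, sval (c k) e -> sval (c l) e.
  move=> /subnK <-; elim: (l - k)%N => // i IH e he.
  by rewrite addSn; apply/cS/IH.
have cn k : ~ (forall e, sval (c k.+1) e -> sval (c k) e).
  move=> h; case: (svalP (step (c k))) => _ [e [h1 h2]].
  by apply/h2/h.
have sub_c k : subm (sval (c k)) by apply: Fsub; exact: (svalP (c k)).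
pose Un a := exists k, sval (c k) a.
have Usub : @subm A^o Un.
  split; first by exists 0%N; exact: subm0.
  move=> a u v [k hu] [l hv]; exists (maxn k l).
  by apply: (proj2 (sub_c _)); [apply: cle hu|apply: cle hv]; lia.
(* [noetherian] speaks of proper ideals, so a union containing 1 is treated apart. *)
have [[k h1]|n1] := pselect (Un 1).
  apply: (cn k) => e _; rewrite -[e]mulr1.
  exact: (@submZ A^o _ (sub_c k) e 1).
have [n [x xgen]] := hA (subm_idealr Usub n1).
have xU i : Un (x i).
  apply/prP; apply: (proj2 (xgen _)); exists (fun j => (j == i)%:R).
  by rewrite (bigD1 i) //= eqxx mul1r big1 ?addr0 // => j /negPf ->; rewrite mul0r.
have [f hf] := choice xU.
pose K := \max_(i < n) f i.
apply: (cn K) => e he.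
have [|u ->] := proj1 (xgen e); first by apply/prP; exists K.+1.
apply: (big_ind (sval (c K))); first exact: (subm0 (sub_c K)).
  by move=> a b; exact: (@submD A^o _ (sub_c K)).
move=> i _; apply: (@submZ A^o _ (sub_c K)); apply: cle (hf i).
exact: (leq_bigmax i).
Qed.

End Noetherian.

(** Two successive choices: a maximal image in W, then a maximal preimage in U among the members
    above one, N1, that realizes this image. Staying above N1 keeps the image maximal, so enlarging
    the result changes neither image nor preimage. *)
Lemma noeth_mod_ext U V W (f : {linear U -> V}) (g : {linear V -> W}) :
  (forall v, g v = 0 -> exists u, v = f u) ->
  noeth_mod U -> noeth_mod W -> noeth_mod V.
Proof.
move=> kerg hU hW F Fsub [N0 FN0].
pose img (N : V -> Prop) w := exists2 v, N v & w = g v.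
have img_sub N : subm N -> subm (img N).
  move=> hN; split; first by exists 0; [exact: subm0|rewrite linear0].
  move=> a _ _ [u hu ->] [v hv ->]; exists (a *: u + v); first exact: (proj2 hN).
  by rewrite linearP.
have [|| _ [[N1 FN1 ->] max1]] := hW (fun X => exists2 N, F N & X = img N).
- by move=> _ [N FN ->]; apply/img_sub/Fsub.
- by exists (img N0), N0.
pose pre (N : V -> Prop) u := N (f u).
have pre_sub N : subm N -> subm (pre N).
  move=> hN; split; first by rewrite /pre linear0; exact: subm0.
  by move=> a u v hu hv; rewrite /pre linearP; exact: (proj2 hN).
have [|| _ [[N2 [FN2 N12] ->] max2]] :=
  hU (fun X => exists2 N, F N /\ (forall e, N1 e -> N e) & X = pre N).
- by move=> _ [N [FN _] ->]; apply/pre_sub/Fsub.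
- by exists (pre N1), N1.
exists N2; split=> // N' FN' N2N' e N'e.
have [v N2v gv] : img N2 (g e).
  have [v N1v gv] : img N1 (g e).
    apply: (max1 (img N')); [by exists N'| |by exists e].
    by move=> _ [v hv ->]; exists v => //; apply/N2N'/N12.
  by exists v => //; exact: N12.
have [u hu] : exists u, e - v = f u.
  by apply: kerg; rewrite linearB gv subrr.
have : pre N2 u.
  apply: (max2 (pre N')).
  - by exists N' => //; split=> // w /N12; exact: N2N'.
  - by move=> w; exact: N2N'.
  - by rewrite /pre -hu; apply: submB => //; [exact: Fsub|exact: N2N'].
rewrite /pre -hu => h; rewrite -[e](subrK v); apply: submD => //; exact: Fsub.
Qed.

Lemma noeth_mod_surj V W (g : {linear V -> W}) :
  (forall w, exists v, w = g v) -> noeth_mod V -> noeth_mod W.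
Proof.
move=> gsurj hV F Fsub [N0 FN0].
pose pre (N : W -> Prop) u := N (g u).
have pre_sub N : subm N -> subm (pre N).
  move=> hN; split; first by rewrite /pre linear0; exact: subm0.
  by move=> a u v hu hv; rewrite /pre linearP; exact: (proj2 hN).
have [|| _ [[N FN ->] maxN]] := hV (fun X => exists2 N, F N & X = pre N).
- by move=> _ [N FN ->]; apply/pre_sub/Fsub.
- by exists (pre N0), N0.
exists N; split=> // N' FN' NN' e N'e.
have [v ev] := gsurj e.
rewrite ev; apply: (maxN (pre N')); [by exists N'|by move=> ?; exact: NN'|].
by rewrite /pre -ev.
Qed.

Lemma noeth_mod_inj U V (f : {linear U -> V}) : injective f -> noeth_mod V -> noeth_mod U.
Proof.
move=> finj hV F Fsub [N0 FN0].
pose img (N : U -> Prop) w := exists2 v, N v & w = f v.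
have img_sub N : subm N -> subm (img N).
  move=> hN; split; first by exists 0; [exact: subm0|rewrite linear0].
  move=> a _ _ [u hu ->] [v hv ->]; exists (a *: u + v); first exact: (proj2 hN).
  by rewrite linearP.
have [|| _ [[N FN ->] maxN]] := hV (fun X => exists2 N, F N & X = img N).
- by move=> _ [N FN ->]; apply/img_sub/Fsub.
- by exists (img N0), N0.
exists N; split=> // N' FN' NN' e N'e.
have [] := maxN (img N') _ _ (f e).
- by exists N'.
- by move=> _ [v hv ->]; exists v => //; exact: NN'.
- by exists e.
by move=> v hv /finj ->.
Qed.

(* Take L maximal among the submodules containing N whose P-saturation does not
   contain T; adding to L some t in T outside its P-saturation puts T inside the
   P-saturation of the sum, and then (s - b a) t lies in L for some s outside P. *)
Lemma nakayama_at (P : {pred A}) E (N T : E -> Prop) a :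
  prime_ideal P -> noeth_mod E -> subm N -> a \in P ->
  (forall t, T t -> exists s n t',
     [/\ s \notin P, N n, T t' & s *: t = n + a *: t']) ->
  forall t, T t -> exists2 s, s \notin P & N (s *: t).
Proof.
move=> hP hE hN aP hT t0 Tt0; apply: contrapT => ht0.
have [|| L [[hL NL [t Tt nt]] maxL]] := hE (fun L => [/\ subm L, forall e, N e -> L e &
    exists2 t, T t & forall s, s \notin P -> ~ L (s *: t)]).
- by move=> ? [].
- by exists N; split=> //; exists t0 => // s hs h; apply: ht0; exists s.
pose L' e := exists l b, L l /\ e = l + b *: t.
have L't : L' t by exists 0, 1; rewrite scale1r add0r; split=> //; exact: subm0.
have LL' e : L e -> L' e by exists e, 0; rewrite scale0r addr0.
have nL' : ~ forall e, L' e -> L e.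
  move=> /(_ _ L't) Lt; apply: (nt 1); first exact: prime1.
  by rewrite scale1r.
have [s0 [n [t1 [s0P Nn Tt1 e1]]]] := hT t Tt.
have [s sP [l [b [Ll e2]]]] : exists2 s, s \notin P & L' (s *: t1).
  apply: contrapT => h; apply: nL'; apply: maxL => //.
  split=> [|e /NL/LL' //|]; first exact: subm_add1.
  by exists t1 => // s hs Ls; apply: h; exists s.
apply: (nt (s * s0 - b * a)).
  by apply: primeB => //; [exact: primeM|exact: prime_absorb].
have -> : (s * s0 - b * a) *: t = s *: n + a *: l.
  rewrite scalerBl -(scalerA s) e1 scalerDr scalerA mulrC -(scalerA a s) e2.
  by rewrite scalerDr scalerA [b * a]mulrC addrA addrK.
by apply: submD => //; apply: submZ => //; exact: NL.
Qed.

Section NoetherianTheory.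
Hypothesis hA : noetherian A.

(** A maximal (N : e) is prime: if v e is outside N, then (N : v e) contains (N : e) and so equals
    it. The last clause exports the maximality for prime avoidance. *)
Lemma ass_prime E (N : E -> Prop) e0 : subm N -> ~ N e0 ->
  exists e, [/\ ~ N e, forall a, N (a *: e0) -> N (a *: e),
    prime_ideal (to_pred (fun a => N (a *: e))) &
    forall f, ~ N f -> (forall a, N (a *: e) -> N (a *: f)) ->
      forall a, N (a *: f) -> N (a *: e)].
Proof.
move=> hN ne0.
have sub e : @subm A^o (fun a => N (a *: e)).
  split; first by rewrite scale0r; exact: subm0.
  move=> a u v hu hv; rewrite scalerDl -scalerA; exact: (proj2 hN).
have [|| _ [[e [ne -> he]] maxe]] := noeth_mod_ring hA (F := fun J =>
    exists e, [/\ ~ N e, J = (fun a => N (a *: e)) &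
      forall a, N (a *: e0) -> N (a *: e)]).
- by move=> _ [e [_ -> _]].
- by exists (fun a => N (a *: e0)), e0.
have maxe' f : ~ N f -> (forall a, N (a *: e) -> N (a *: f)) ->
    forall a, N (a *: f) -> N (a *: e).
  move=> nf ef; apply: (maxe (fun a => N (a *: f))) => //.
  by exists f; split=> // a /he/ef.
exists e; split=> //.
apply: prime_intro => //; first by rewrite scale1r.
move=> u v huv; have [hv|nv] := pselect (N (v *: e)); first by right.
left; apply: (maxe' (v *: e)) => //; last by rewrite scalerA.
by move=> a hae; rewrite scalerA mulrC -scalerA; apply: submZ.
Qed.

(** An ideal maximal among those containing J and missing S is prime. *)
Lemma prime_disjoint (S J : A -> Prop) : S 1 ->
  (forall s t, S s -> S t -> S (s * t)) ->
  @subm A^o J -> (forall a, J a -> ~ S a) ->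
  exists Q, [/\ prime_ideal Q, forall a, J a -> a \in Q & forall a, a \in Q -> ~ S a].
Proof.
move=> S1 SM hJ JS.
have [|| Q [[hQ JQ QS] maxQ]] := noeth_mod_ring hA (F := fun Q =>
    [/\ subm Q, forall a, J a -> Q a & forall a, Q a -> ~ S a]).
- by move=> ? [].
- by exists J.
exists (to_pred Q); split; [|by move=> a /JQ/prP|by move=> a /prP/QS].
apply: prime_intro => //; first by move/QS.
move=> u v Quv; apply: contrapT => /not_orP[nu nv].
have key w : ~ Q w -> exists b q, Q q /\ S (q + b * w).
  move=> nw; apply: contrapT => h; apply: nw.
  apply: (maxQ (fun e => exists n b, Q n /\ e = n + b *: (w : A^o))).
  - split; first exact: subm_add1.
      by move=> a /JQ Qa; exists a, 0; rewrite scale0r addr0.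
    by move=> _ [n [b [Qn ->]]] hS; apply: h; exists b, n.
  - by move=> a Qa; exists a, 0; rewrite scale0r addr0.
  - by exists 0, 1; rewrite scale1r add0r; split=> //; exact: subm0.
have [b [q [Qq Su]]] := key u nu; have [c [r [Qr Sv]]] := key v nv.
apply: (QS ((q + b * u) * (r + c * v))); last exact: SM.
rewrite mulrDl mulrDr -addrA; apply: (@submD A^o _ hQ).
  by rewrite mulrC; apply: (@submZ A^o _ hQ).
rewrite mulrDr addrA; apply: (@submD A^o _ hQ).
  rewrite [q * _]mulrC; apply: (@submD A^o _ hQ); exact: (@submZ A^o _ hQ).
by rewrite mulrACA; apply: (@submZ A^o _ hQ).
Qed.

End NoetherianTheory.

End Submodules.

(** * Prime ideals, zero divisors and the principal ideal theorem *)

Section PrimeIdeals.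
Variable A : comNzRingType.
Hypothesis hA : noetherian A.
Implicit Types (E : lmodType A) (P Q : {pred A}).

Lemma not_subset (T : Type) (X Y : {pred T}) :
  ~ {subset X <= Y} -> exists2 a, a \in X & a \notin Y.
Proof.
move=> h; apply: contrapT => h'; apply: h => a aX; apply: contrapT => /negP aY.
by apply: h'; exists a.
Qed.

Fixpoint seq_span E (es : seq E) : E -> Prop :=
  if es is e :: es' then fun f => exists n b, seq_span es' n /\ f = n + b *: e
  else fun f => f = 0.

Lemma seq_span_subm E (es : seq E) : subm (seq_span es).
Proof.
elim: es => [|e es IH] /=; last exact: subm_add1.
by split=> // a u v -> ->; rewrite scaler0 addr0.
Qed.

Lemma seq_span_mem E (es : seq E) e : e \in es -> seq_span es e.
Proof.
elim: es => [//|f es IH]; rewrite inE => /orP[/eqP ->|/IH h] /=.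
  by exists 0, 1; rewrite scale1r add0r; split=> //; exact: subm0 (seq_span_subm es).
by exists e, 0; rewrite scale0r addr0.
Qed.

Lemma seq_span_ann E (N : E -> Prop) (es : seq E) a : subm N ->
  (forall e, e \in es -> N (a *: e)) -> forall f, seq_span es f -> N (a *: f).
Proof.
move=> hN; elim: es => [_ _ ->|e es IH h _ [n [b [hn ->]]]].
  by rewrite scaler0; exact: subm0.
rewrite scalerDr scalerA mulrC -scalerA; apply: submD => //.
  by apply: IH => // f fes; apply: h; rewrite inE fes orbT.
by apply: submZ => //; apply: h; rewrite inE eqxx.
Qed.

(** * Prime avoidance and zero divisors on a noetherian module *)

Section ZeroDivisors.
Variables (E : lmodType A) (N : E -> Prop).
Hypotheses (hE : noeth_mod E) (hN : subm N).

(* (N : e) is maximal among the (N : f) with f not in N *)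
Let good e := [/\ ~ N e, prime_ideal (to_pred (fun a => N (a *: e))) &
    forall f, ~ N f -> (forall a, N (a *: e) -> N (a *: f)) ->
      forall a, N (a *: f) -> N (a *: e)].

(** Otherwise each e in es has a multiplier outside P sending it into N, and the product of these
    multipliers sends all of es into N without lying in P. *)
Lemma prime_contains_ann P (es : seq E) : prime_ideal P ->
  (forall a, (forall e, e \in es -> N (a *: e)) -> a \in P) ->
  exists2 e, e \in es & forall a, N (a *: e) -> a \in P.
Proof.
move=> hP; elim: es => [h|e es IH h].
  by have := prime1 hP; rewrite h.
have [he|] := pselect (forall a, N (a *: e) -> a \in P).
  by exists e; rewrite ?inE ?eqxx.
move=> /existsNP[b /not_implyP[Nbe /negP bP]].
have [|f fes hf] := IH; last by exists f; rewrite ?inE ?fes ?orbT.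
move=> a ha; apply: contrapT => /negP aP.
have /negP := primeM hP aP bP; apply; apply: h => f; rewrite inE.
case/orP=> [/eqP ->|/ha h]; first by rewrite -scalerA; exact: submZ.
by rewrite mulrC -scalerA; exact: submZ.
Qed.

Lemma prime_avoidance (J : A -> Prop) (es : seq E) : @subm A A^o J ->
  (exists a, J a) -> (forall e, e \in es -> good e) ->
  (forall a, J a -> exists2 e, e \in es & N (a *: e)) ->
  exists2 e, e \in es & forall a, J a -> N (a *: e).
Proof.
move=> hJ [a0 Ja0]; elim: es => [_ /(_ _ Ja0)[]//|e es IH hes cov].
have hes' f : f \in es -> good f by move=> fes; apply: hes; rewrite inE fes orbT.
have [cov'|] := pselect (forall a, J a -> exists2 e, e \in es & N (a *: e)).
  by have [f fes hf] := IH hes' cov'; exists f; rewrite ?inE ?fes ?orbT.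
move=> /existsNP[x /not_implyP[Jx nx]].
have he : good e by apply: hes; rewrite inE eqxx.
have hPe : prime_ideal (to_pred (fun a => N (a *: e))) by case: he.
have Nxe : N (x *: e).
  by have [f] := cov x Jx; rewrite inE => /orP[/eqP -> //|fes hf]; case: nx; exists f.
have [//|] := pselect (forall a, J a -> N (a *: e)).
  by exists e; rewrite ?inE ?eqxx.
move=> /existsNP[y /not_implyP[Jy nye]].
(* If no such w existed, some (N : f) with f in es would lie in (N : e), hence equal it by
   maximality and contain x. With w at hand, x + w y escapes every prime. *)
have [w wes nwe] : exists2 w, (forall f, f \in es -> N (w *: f)) & ~ N (w *: e).
  apply: contrapT => hno.
  have [|f fes hf] := @prime_contains_ann _ es hPe.
    by move=> a ha; apply/prP; apply: contrapT => nae; apply: hno; exists a.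
  case: nx; exists f => //.
  have [nf _ maxf] := hes' f fes; apply: (maxf e) => //; first by case: he.
  by move=> a /hf/prP.
have [f] : exists2 e0, e0 \in e :: es & N ((x + w * y) *: e0).
  by apply: cov; apply: (@submD A A^o _ hJ) => //; apply: (@submZ A A^o _ hJ).
rewrite inE scalerDl => /orP[/eqP ->|fes] h.
  have : w * y \notin to_pred (fun a => N (a *: e)).
    by apply: primeM => //; apply/negP => /prP.
  move=> /negP[]; apply/prP; rewrite -[_ *: _](addKr (x *: e)) addrC.
  by apply: submB.
case: nx; exists f => //; rewrite -[_ *: _](addrK ((w * y) *: f)).
apply: submB => //; rewrite mulrC -scalerA; apply: submZ => //; exact: wes.
Qed.

(** Finiteness of the set of primes to avoid comes from a maximal span of good elements es: any good
    e lies in it, so the intersection of the (N : f), f in es, is inside (N : e), and by maximality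
    one of them equals (N : e). *)
Lemma zero_divisors_common (J : A -> Prop) : @subm A A^o J ->
  (forall a, J a -> exists2 e, ~ N e & N (a *: e)) ->
  exists2 e, ~ N e & forall a, J a -> N (a *: e).
Proof.
move=> hJ hz.
have [|| _ [[es -> hes] maxes]] := hE (F := fun L =>
    exists2 es, L = seq_span es & forall e, e \in es -> good e).
- by move=> _ [es -> _]; exact: seq_span_subm.
- by exists (seq_span [::]), [::].
have [||e ees he] := @prime_avoidance J es hJ _ hes.
- by exists 0; exact: subm0 hJ.
- move=> a /hz[e0 ne0 hae0].
  have [e [ne e0e he maxe]] := ass_prime hA hN ne0.
  have seq_span_e : seq_span es e.
    apply: (maxes (seq_span (e :: es))) => [|f hf|]; last exact: seq_span_mem (mem_head _ _).
    - by exists (e :: es) => // f; rewrite inE => /orP[/eqP -> //|/hes].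
    - by exists f, 0; rewrite scale0r addr0.
  have [|f fes hf] := @prime_contains_ann _ es he.
    by move=> b hb; apply/prP; apply: seq_span_ann seq_span_e.
  have [nf _ maxf] := hes f fes.
  by exists f => //; apply: (maxf e) => // [b /hf/prP //|]; exact: e0e.
- by exists e => //; case: (hes e ees).
Qed.

End ZeroDivisors.

Section Local.
Variable M : {pred A}.
Hypothesis hM : local_ring M.

Lemma local_unit a : a \notin M -> exists b, b * a = 1.
Proof.
move=> aM; apply: contrapT => hno.
have [|| L [[hL L1 La] maxL]] := noeth_mod_ring hA (F := fun L : A^o -> Prop =>
    [/\ subm L, ~ L 1 & L a]).
- by move=> ? [].
- exists (fun e => exists n b, n = 0 /\ e = n + b *: (a : A^o)); split.
  + apply: (@subm_add1 A A^o (fun e => e = 0)).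
    by split=> // b u v -> ->; rewrite scaler0 addr0.
  + by move=> [_ [b [-> h]]]; apply: hno; exists b; rewrite h add0r.
  + by exists 0, 1; rewrite scale1r add0r.
have LM : to_pred L =i M.
  apply: (proj2 hM); split; first exact: subm_idealr.
  move=> J hJ LJ b bJ; apply/prP; apply: (maxL (fun x => x \in J)) bJ.
    split; first exact: idealr_subm.
    - by move=> J1; case: hJ => _; rewrite J1.
    - exact/LJ/prP.
  by move=> e Le; exact/LJ/prP.
by move: aM; rewrite -LM => /negP; apply; apply/prP.
Qed.

Lemma maximal_prime : prime_ideal M.
Proof.
have hi : idealr_closed M by case: hM => -[].
split=> // u v huv; apply/orP; have [uM|uM] := boolP (u \in M); first by left.
right; have [b hb] := local_unit uM; rewrite -[v]mul1r -hb -mulrA.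
exact: (@submZ A A^o _ (idealr_subm hi) b (u * v)).
Qed.

Lemma nakayama E (N T : E -> Prop) a :
  noeth_mod E -> subm N -> a \in M ->
  (forall t, T t -> exists n t', [/\ N n, T t' & t = n + a *: t']) ->
  forall t, T t -> N t.
Proof.
move=> hE hN aM h t Tt.
have [|s sM hs] := nakayama_at maximal_prime hE hN aM _ Tt.
  move=> u /h[n [t' [Nn Tt' ->]]]; exists 1, n, t'.
  by rewrite scale1r; split=> //; exact: prime1 maximal_prime.
have [b hb] := local_unit sM.
by rewrite -[t]scale1r -hb -scalerA; exact: submZ.
Qed.

Lemma proper_sub_maximal (J : A -> Prop) :
  @subm A A^o J -> ~ J 1 -> forall a, J a -> a \in M.
Proof.
move=> hJ J1 a Ja; apply: contrapT => /negP/local_unit[b hb].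
by apply: J1; rewrite -hb; exact: (@submZ A A^o _ hJ).
Qed.

End Local.

(* If P2 were minimal over P0 + (z), ideals would satisfy the descending chain
   condition modulo P0 + (z), locally at P2. Applied to the P1-saturations L n of
   (x^n) + P0, with x in P1 but not in P0, this and Nakayama's lemma give
   L n = L n.+1, which is absurd. *)
Lemma principal_ideal_prime P0 P1 P2 z :
  prime_ideal P0 -> prime_ideal P1 -> prime_ideal P2 ->
  {subset P0 <= P1} -> ~ {subset P1 <= P0} ->
  {subset P1 <= P2} -> z \in P2 -> z \notin P1 ->
  exists Q, [/\ prime_ideal Q, {subset P0 <= Q}, z \in Q,
    {subset Q <= P2} & ~ {subset P2 <= Q}].
Proof.
move=> h0 h1 h2 s01 /not_subset[x x1 x0] s12 z2 z1; apply: contrapT => hno.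
have {hno} P2min Q : prime_ideal Q -> {subset P0 <= Q} -> z \in Q ->
    {subset Q <= P2} -> {subset P2 <= Q}.
  by move=> *; apply: contrapT => ?; apply: hno; exists Q.
have s0 := prime_subm h0; have s1 := prime_subm h1; have s2 := prime_subm h2.
pose I0 (a : A^o) := exists p b, p \in P0 /\ a = p + b *: (z : A^o).
have hI0 : subm I0 by exact: subm_add1.
pose L n (a : A^o) := exists t b, [/\ t \notin P1 & t * a - b * x ^+ n \in P0].
have hL n : subm (L n).
  split; first by exists 1, 0; rewrite mulr0 mul0r subrr (prime1 h1) (subm0 s0).
  move=> a u v [t [b [t1 hu]]] [t' [b' [t1' hv]]].
  exists (t * t'), (a * t' * b + t * b'); split; first exact: primeM.
  rewrite (_ : _ - _ = (a * t') * (t * u - b * x ^+ n) + t * (t' * v - b' * x ^+ n)).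
    by apply: (submD s0); apply: prime_absorb.
  by rewrite /GRing.scale /=; ring.
have Ldec n a : L n.+1 a -> L n a.
  by move=> [t [b [t1 h]]]; exists t, (b * x); rewrite -mulrA -exprS.
have P0L n a : a \in P0 -> L n a.
  by exists 1, 0; rewrite mul1r mul0r subr0 (prime1 h1).
have zL n b : L n (b * z) -> L n b.
  move=> [t [c [t1 h]]]; exists (t * z), c; split; first exact: primeM.
  by rewrite -mulrA [z * b]mulrC.
(* The decreasing chain of the intersections of V with [L n] is eventually stationary modulo I0, up
   to factors outside P2. It holds trivially for I0; the aim is a V not contained in P2. *)
pose Dcc (V : A^o -> Prop) := exists n0, forall n, (n0 <= n)%N -> forall a,
  L n a -> V a -> exists s l i, [/\ s \notin P2, L n.+1 l, V l, I0 i & s * a = l + i].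
have [|| V [[hV IV [n0 DV]] maxV]] := noeth_mod_ring hA (F := fun V : A^o -> Prop =>
    [/\ subm V, forall a, I0 a -> V a & Dcc V]).
- by move=> ? [].
- exists I0; split=> //; exists 0%N => n _ a _ ha; exists 1, 0, a.
  by rewrite mul1r add0r (prime1 h2); split=> //; exact: subm0.
(* Were V inside P2, minimality of P2 would give an e with P2 inside (satV : e), so that V + A e
   exceeds V by a copy of the residue field at P2; [Dcc] would pass to V + A e, against
   maximality. *)
have [v0 Vv0 v02] : exists2 v, V v & v \notin P2.
  apply: contrapT => hno.
  have VP2 v : V v -> v \in P2.
    by move=> Vv; apply: contrapT => /negP ?; apply: hno; exists v.
  pose satV (a : A^o) := exists2 s, s \notin P2 & V (s * a).
  have Vsat a : V a -> satV a by exists 1; rewrite ?mul1r ?(prime1 h2).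
  have hsat : subm satV.
    split; first exact: (Vsat _ (subm0 hV)).
    move=> a u v [s s2' hu] [t t2 hv]; exists (s * t); first exact: primeM.
    rewrite (_ : _ * _ = (a * t) *: (s * u : A^o) + s *: (t * v : A^o)).
      by apply: (submD hV); apply: (submZ hV).
    by rewrite /GRing.scale /=; ring.
  have n1 : ~ satV 1 by move=> [s /negP s2' ]; rewrite mulr1 => /VP2.
  have [e [ne e1 hQ _]] := ass_prime hA hsat n1.
  have IQ a : I0 a -> a \in to_pred (fun a => satV (a *: (e : A^o))).
    by move=> /IV Va; apply/prP/e1; rewrite /GRing.scale /= mulr1; exact: Vsat.
  have P2Q : {subset P2 <= to_pred (fun a => satV (a *: (e : A^o)))}.
    apply: P2min => //.
    - by move=> a a0; apply: IQ; exists a, 0; rewrite scale0r addr0.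
    - by apply: IQ; exists 0, 1; rewrite scale1r add0r (subm0 s0).
    - move=> a /prP[s s2' hs]; apply: contrapT => /negP a2; apply: ne.
      exists (s * a); first exact: primeM.
      by rewrite -mulrA.
  apply: ne; apply: Vsat.
  apply: (maxV (fun e' => exists n b, V n /\ e' = n + b *: (e : A^o))); last 2 first.
  - by move=> u Vu; exists u, 0; rewrite scale0r addr0.
  - by exists 0, 1; rewrite scale1r add0r; split=> //; exact: subm0.
  split; first exact: subm_add1.
    by move=> a /IV Va; exists a, 0; rewrite scale0r addr0.
  (* Either the coefficients of e in elements of [L n] eventually lie in P2, and a multiple of a
     falls back into V; or every [L n] has an element whose coefficient is outside P2, which serves
     to eliminate e. *)
  have [[n1' hn1]|hcase] := pselect (exists n1, forall v u, V v ->
      L n1 (v + u *: (e : A^o)) -> u \in P2).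
    exists (maxn n0 n1') => n hn a La [v [u [Vv ea]]].
    have Ldec' : L n1' a.
      have : (n1' <= n)%N by lia.
      move=> /subnK; move: La => /[swap] <-; elim: (n - n1')%N => // k IHk.
      by rewrite addSn => /Ldec.
    have u2 : u \in P2 by apply: (hn1 v) => //; rewrite -ea.
    have /prP[s s2' hs] := P2Q u u2.
    have Vsa : V (s * a).
      rewrite ea (_ : s * _ = s *: v + s * (u *: (e : A^o))); last by rewrite mulrDr.
      by apply: (submD hV) => //; apply: (submZ hV).
    have [||s' [l [i [s2'' Ll Vl Ii hs']]]] := DV n _ (s * a) _ Vsa; first lia.
      exact: (submZ (hL n) s La).
    exists (s' * s), l, i; split=> //; first exact: primeM.
      by exists l, 0; rewrite scale0r addr0.
    by rewrite -mulrA.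
  exists n0 => n hn a La [v [u [Vv ea]]].
  have [v' [u' [Vv' Lv' u2]]] : exists v' u',
      [/\ V v', L n.+1 (v' + u' *: (e : A^o)) & u' \notin P2].
    apply: contrapT => hno'; apply: hcase; exists n.+1 => v' u' Vv' Lv'.
    by apply: contrapT => /negP ?; apply: hno'; exists v', u'.
  set l' := v' + _ in Lv'.
  have Lc : L n (u' *: a - u *: l').
    by apply: (submB (hL n)); apply: (submZ (hL n)) => //; exact: Ldec.
  have Vc : V (u' *: a - u *: l').
    rewrite (_ : _ - _ = u' *: v - u *: v').
      by apply: (submB hV); apply: (submZ hV).
    by rewrite ea /l' /GRing.scale /=; ring.
  have [s [l [i [s2' Ll Vl Ii hs]]]] := DV n hn _ Lc Vc.
  exists (s * u'), (l + (s * u) *: l'), i; split=> //.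
  - exact: primeM.
  - by apply: (submD (hL _)) => //; exact: (submZ (hL _)).
  - exists (l + (s * u) *: v'), (s * u * u'); split.
      by apply: (submD hV) => //; exact: (submZ hV).
    by rewrite /l' /GRing.scale /=; ring.
  - have -> : l = s * (u' *: a - u *: l') - i by rewrite hs addrK.
    by rewrite /GRing.scale /=; ring.
have {}DV a : L n0 a -> exists s l i, [/\ s \notin P2, L n0.+1 l, I0 i & s * a = l + i].
  move=> La; have [|| s [l [i [s2' Ll _ Ii hs]]]] := DV n0 (leqnn _) (v0 * a).
  - exact: (submZ (hL _)).
  - by rewrite mulrC; exact: (submZ hV).
  - exists (s * v0), l, i; split=> //; first exact: primeM.
    by rewrite -mulrA.
(* As z is outside P1, b z in [L n0] forces b in [L n0]; hence, up to factors outside P2, [L n0]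
   lies in [L n0.+1] + z [L n0]. *)
have [||s s2' [t [b [t1 htb]]]] := @nakayama_at A P2 A^o (L n0.+1) (L n0) z h2
    (noeth_mod_ring hA) (hL _) z2 _ (x ^+ n0).
- move=> a La; have [s [l [_ [s2' Ll [p [b [p0 ->]]] hs]]]] := DV a La.
  exists s, (l + p), b; split=> //.
  + by apply: (submD (hL _)) => //; exact: P0L.
  + apply: zL; rewrite (_ : b * z = s *: (a : A^o) - l - p).
      apply: (submB (hL _)); last exact: P0L.
      by apply: (submB (hL _)); [exact: (submZ (hL _))|exact: Ldec].
    by rewrite [s *: _]hs /GRing.scale /=; ring.
  + by rewrite [s *: _]hs /GRing.scale /= [z * b]mulrC; ring.
- by exists 1, 1; rewrite mul1r subrr (prime1 h1) (subm0 s0).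
have s1' : s \notin P1 by apply: contra s2' => /s12.
have : (t * s - b * x) * x ^+ n0 \in P0.
  by rewrite mulrBl -!mulrA -exprS; exact: htb.
move=> /(proj2 h0); rewrite (negPf (primeX h0 n0 x0)) orbF => /s01.
apply/negP; apply: primeB => //; [exact: primeM|exact: prime_absorb].
Qed.

End PrimeIdeals.

(** * Regular sequences and chains of primes *)

Section SeqMul.
Variables (A : comNzRingType) (E : lmodType A).
Implicit Types s : seq A.

Lemma seq_mul_nil (e : E) : seq_mul [::] e <-> e = 0.
Proof.
split=> [[u ->]|->]; first by rewrite big_ord0.
by exists (fun=> 0); rewrite big_ord0.
Qed.

Lemma seq_mul_rcons s a (e : E) :
  seq_mul (rcons s a) e <-> exists n f, seq_mul s n /\ e = n + a *: f.
Proof.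
split=> [[u ->]|[_ [f [[u ->] ->]]]].
  exists (\sum_(i < size s) s`_i *: u i), (u (size s)); split; first by exists u.
  rewrite size_rcons big_ord_recr /= nth_rcons ltnn eqxx; congr (_ + _).
  by apply: eq_bigr => i _; rewrite nth_rcons ltn_ord.
exists (fun i => if (i < size s)%N then u i else f).
rewrite size_rcons big_ord_recr /= nth_rcons ltnn eqxx; congr (_ + _).
by apply: eq_bigr => i _; rewrite nth_rcons ltn_ord.
Qed.

Lemma seq_mul_subm s : subm (@seq_mul A E s).
Proof.
elim/last_ind: s => [|s a IH].
  split; first by apply/seq_mul_nil.
  by move=> a u v /seq_mul_nil -> /seq_mul_nil ->; apply/seq_mul_nil; rewrite scaler0 addr0.
have [h0 h] := subm_span a IH; split; first exact/seq_mul_rcons.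
by move=> b u v /seq_mul_rcons hu /seq_mul_rcons hv; apply/seq_mul_rcons; apply: h.
Qed.

Lemma seq_mul_takeS s i (e : E) : (i < size s)%N ->
  seq_mul (take i.+1 s) e <-> exists n f, seq_mul (take i s) n /\ e = n + s`_i *: f.
Proof. by move=> hi; rewrite (take_nth 0) //; exact: seq_mul_rcons. Qed.

Lemma seq_mul_mem s (J : E -> Prop) : subm J ->
  (forall a f, a \in s -> J (a *: f)) -> forall e, seq_mul s e -> J e.
Proof.
move=> hJ h _ [u ->]; apply: big_ind; first exact: subm0.
  by move=> x y; exact: submD.
by move=> i _; apply/h/mem_nth.
Qed.

Lemma regular_rcons s a : regular_seq E s ->
  (forall e : E, seq_mul s (a *: e) -> seq_mul s e) ->
  (exists e : E, ~ seq_mul (rcons s a) e) -> regular_seq E (rcons s a).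
Proof.
move=> [_ hs] ha hne; split=> // i; rewrite size_rcons ltnS => hi e.
rewrite -cats1 takel_cat // cats1 nth_rcons.
case: ltnP => hi'; first exact: hs.
have -> : i = size s by apply/eqP; rewrite eqn_leq hi hi'.
by rewrite eqxx take_size; exact: ha.
Qed.

End SeqMul.

Lemma seq_mul_codom (A : comNzRingType) n (x : 'I_n -> A) (e : A^o) :
  seq_mul [seq x i | i <- enum 'I_n] e <-> exists u : 'I_n -> A, e = \sum_(i < n) u i * x i.
Proof.
have sz : size [seq x i | i <- enum 'I_n] = n by rewrite size_map size_enum_ord.
have nthx (i : 'I_n) : [seq x i | i <- enum 'I_n]`_i = x i.
  by rewrite (nth_map i) ?size_enum_ord // nth_ord_enum.
split=> -[u ->].
  exists (fun i => u i); rewrite sz; apply: eq_bigr => i _.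
  by rewrite nthx mulrC.
exists (fun k => if insub k is Some i then u i else 0); rewrite sz.
by apply: eq_bigr => i _; rewrite nthx valK mulrC.
Qed.

Section Chains.
Variable A : comNzRingType.
Hypothesis hA : noetherian A.
Implicit Types (P Q : {pred A}) (p q : nat -> {pred A}).

Lemma chain_mono n p i j : prime_chain n p -> (i <= j)%N -> (j <= n)%N ->
  {subset p i <= p j}.
Proof.
move=> [_ hp] /subnK <-; elim: (j - i)%N => [|k IH] hk a ha //.
by rewrite addSn; apply: (proj1 (hp (k + i)%N _)); [lia|apply: IH => //; lia].
Qed.

Lemma chain_snoc n p Q : prime_chain n p -> prime_ideal Q ->
  {subset p n <= Q} -> ~ {subset Q <= p n} ->
  exists q, [/\ prime_chain n.+1 q, forall i, (i <= n)%N -> q i = p i & q n.+1 = Q].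
Proof.
move=> [hp hs] hQ s1 s2; exists (fun i => if (i <= n)%N then p i else Q).
split=> [|i -> //|]; last by rewrite ltnn.
split=> i hi; first by case: ifP => // h; apply: hp.
have -> : (i <= n)%N by lia.
by case: ltnP => h; [apply: hs|have -> : i = n by lia].
Qed.

Lemma chain_cons n p Q : prime_chain n p -> prime_ideal Q ->
  {subset Q <= p 0%N} -> ~ {subset p 0%N <= Q} ->
  exists q, prime_chain n.+1 q /\ q 0%N = Q.
Proof.
move=> [hp hs] hQ s1 s2; exists (fun i => if i is j.+1 then p j else Q).
by split=> //; split=> -[|i] //=; [exact: hp|exact: hs].
Qed.

(** One step is given up so that z lies in every prime. If z is not yet in the prime just below the
    top, [principal_ideal_prime] exchanges that prime for one containing z, and the exchange
    continues downwards. *)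
Lemma chain_shift n p z : prime_chain n.+1 p -> z \in p n.+1 ->
  exists q, [/\ prime_chain n q, {subset p 0%N <= q 0%N}, z \in q 0%N & q n = p n.+1].
Proof.
elim: n p => [|n IH] p hp hz.
  exists (fun=> p 1%N); split=> //; last exact: (chain_mono hp).
  by split=> // i _; exact: (proj1 hp).
have [prm str] := hp.
have [z1|z1] := boolP (z \in p n.+1).
  have [|q [hq s0 zq qn]] := IH p _ z1.
    by split=> i hi; [apply: prm|apply: str]; lia.
  have [||| q' [hq' eq' lq']] := chain_snoc (Q := p n.+2) hq.
  - exact: prm.
  - by rewrite qn; case: (str n.+1).
  - by rewrite qn; case: (str n.+1).
  by exists q'; rewrite lq' (eq' 0%N).
have [||||||||Q [hQ s1 zQ s2 s3]] := @principal_ideal_prime _ hA (p n) (p n.+1) (p n.+2) z.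
- by apply: prm; lia.
- by apply: prm; lia.
- exact: prm.
- by case: (str n).
- by case: (str n).
- by case: (str n.+1).
- by [].
- by [].
have [||p' [hp' ep' lp']] := @chain_snoc n p Q _ hQ s1.
- by split=> i hi; [apply: prm|apply: str]; lia.
- move=> /(_ z zQ) zpn; move/negP: z1; apply.
  by case: (str n _) => // h _; exact: h.
have [|q [hq s0 zq qn]] := IH p' hp'; first by rewrite lp'.
have [||| q' [hq' eq' lq']] := chain_snoc (Q := p n.+2) hq.
- exact: prm.
- by rewrite qn lp'.
- by rewrite qn lp'.
by exists q'; rewrite lq' (eq' 0%N) // -(ep' 0%N).
Qed.

Section LocalChains.
Variable M : {pred A}.
Hypothesis hM : local_ring M.

Let hpM := maximal_prime hA hM.

Lemma prime_sub_maximal P : prime_ideal P -> {subset P <= M}.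
Proof.
move=> hP; apply: (proper_sub_maximal hA hM (prime_subm hP)).
exact/negP/prime1.
Qed.

Lemma chain_top n p : prime_chain n p ->
  {subset M <= p n} \/
  exists q, [/\ prime_chain n.+1 q, q 0%N = p 0%N & {subset M <= q n.+1}].
Proof.
move=> hp; have [?|h] := pselect {subset M <= p n}; [by left|right].
have [q [hq eq lq]] := chain_snoc hp hpM (prime_sub_maximal (proj1 hp n (leqnn _))) h.
exists q; rewrite lq (eq 0%N) //; split=> // a.
Qed.

(** * Lengths of chains and generators of the maximal ideal *)

Section Generators.
Variable z : seq A.
Hypotheses (zM : {subset z <= M})
  (Mz : forall a, a \in M -> @seq_mul A A^o z a).

(** [chain_shift] trades one step of the chain for one more generator in the bottom prime. For a
    chain of extreme length z_i is not in p 0, so p 0 lies in (z_0, ..., z_{i-1}) + z_i p 0 and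
    Nakayama gives the equality clause, on which regularity of z rests. *)
Lemma top_chain_bound k i n p : (i + k)%N = size z -> prime_chain n p ->
  {subset M <= p n} -> (forall a, @seq_mul A A^o (take i z) a -> a \in p 0%N) ->
  (n <= k)%N /\ (n = k -> forall a, a \in p 0%N -> @seq_mul A A^o (take i z) a).
Proof.
elim: k i n p => [|k IH] i n p hik hp hMp hJ.
  have ei : i = size z by lia.
  have Mp0 : {subset M <= p 0%N} by move=> a aM; apply: hJ; rewrite ei take_size; exact: Mz.
  case: n hp {hMp} => [|n] hp.
    split=> // _ a ha; rewrite ei take_size; apply: Mz.
    exact: (prime_sub_maximal (proj1 hp 0%N (leqnn _))).
  have [_ []] := proj2 hp 0%N (ltn0Sn _).
  by move=> a ha; apply/Mp0/(prime_sub_maximal (proj1 hp 1%N (ltn0Sn _))).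
case: n hp hMp => [//|n] hp hMp.
have iz : (i < size z)%N by lia.
have ziM : z`_i \in M by apply/zM/mem_nth.
have JS q : prime_ideal (q 0%N) -> z`_i \in q 0%N ->
    (forall a, @seq_mul A A^o (take i z) a -> a \in q 0%N) ->
    forall a, @seq_mul A A^o (take i.+1 z) a -> a \in q 0%N.
  move=> hq zq Jq a /seq_mul_takeS[//|m [f [/Jq mq ->]]].
  apply: (submD (prime_subm hq)) => //; rewrite [_ *: _]mulrC; exact: prime_absorb.
have [q [hq s0 zq qn]] := chain_shift hp (hMp _ ziM).
have hp0 := proj1 hp 0%N (leq0n _).
have hq0 := proj1 hq 0%N (leq0n _).
have [|||nk hk] := IH i.+1 n q _ hq; first lia.
- by rewrite qn.
- by apply: JS => // a /hJ/s0.
split=> // -[en] a ha; move: a ha.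
have zp0 : z`_i \notin p 0%N.
  apply/negP => zp; have [||||] := IH i.+1 n.+1 p; [lia|by []|by []| |lia].
  exact: JS.
apply: (nakayama hA hM (noeth_mod_ring hA) (seq_mul_subm _ _) ziM) => t tp.
have /seq_mul_takeS[//|m [f [hm et]]] := hk en t (s0 t tp).
exists m, f; split=> //.
have : z`_i * f \in p 0%N.
  rewrite (_ : _ * _ = t - m); last by rewrite et addrC addKr.
  by apply: (submB (prime_subm hp0)) => //; exact: hJ.
by move=> /(proj2 hp0); rewrite (negPf zp0).
Qed.

Lemma chain_bound k i n p : (i + k)%N = size z -> prime_chain n p ->
  (forall a, @seq_mul A A^o (take i z) a -> a \in p 0%N) -> (n <= k)%N.
Proof.
move=> hik hp hJ; have [h|[q [hq q0 h]]] := chain_top hp.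
  by have [] := top_chain_bound hik hp h hJ.
by rewrite -q0 in hJ; have [/ltnW] := top_chain_bound hik hq h hJ.
Qed.

(* dim A = |z| forces every (z_0, ..., z_{i-1}) to be prime. *)
Lemma generators_regular p : prime_chain (size z) p -> regular_seq A^o z.
Proof.
move=> hp.
have [h|[q [hq q0 h]]] := chain_top hp; last first.
  have [|+ _] := top_chain_bound (add0n (size z)) hq h; last by rewrite ltnn.
  by move=> a; rewrite take0 => /seq_mul_nil ->; apply: subm0 (prime_subm (proj1 hq _ _)).
have chains i : (i <= size z)%N -> exists q, [/\ prime_chain (size z - i) q,
    {subset M <= q (size z - i)%N} &
    forall a, @seq_mul A A^o (take i z) a -> a \in q 0%N].
  elim: i => [_|i IH hi].
    exists p; rewrite subn0; split=> // a; rewrite take0 => /seq_mul_nil ->.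
    by apply: subm0 (prime_subm (proj1 hp _ _)).
  have [|q [hq hMq Jq]] := IH; first lia.
  have e : (size z - i = (size z - i.+1).+1)%N by lia.
  rewrite e in hq hMq.
  have ziM : z`_i \in M by apply/zM/mem_nth.
  have [q' [hq' s0 zq' qn]] := chain_shift hq (hMq _ ziM).
  exists q'; rewrite qn; split=> // a /seq_mul_takeS[//|m [f [/Jq/s0 mq ->]]].
  have hq0 := proj1 hq' 0%N (leq0n _).
  apply: (submD (prime_subm hq0)) => //; rewrite [_ *: _]mulrC; exact: prime_absorb.
split.
  exists 1 => -/(@seq_mul_mem A A^o z (fun a => a \in M) (prime_subm hpM)) h1.
  have /negP := prime1 hpM; apply; apply: h1 => a f /zM aM.
  by rewrite [_ *: _]mulrC; exact: prime_absorb.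
move=> i hi e he; have [|q [hq hMq Jq]] := chains i; first lia.
have [|_ hJ] := top_chain_bound (k := (size z - i)%N) (i := i) _ hq hMq Jq; first lia.
have hq0 := proj1 hq 0%N (leq0n _).
(* If z_i were in q 0, the chain q would lie above (z_0, ..., z_i), where chains are shorter by
   one. *)
have /(proj2 hq0)/orP[zq|eq] := Jq _ he; last exact: hJ.
suff : (size z - i <= size z - i.+1)%N by lia.
apply: (@chain_bound (size z - i.+1) i.+1 _ q) => //; first lia.
move=> a /seq_mul_takeS[//|m [f [/Jq mq ->]]].
apply: (submD (prime_subm hq0)) => //; rewrite [_ *: _]mulrC; exact: prime_absorb.
Qed.

End Generators.

(** Let T consist of the t with (N : e) inside (N : t). If T were inside N + a E, cancelling a
    modulo N would put T inside N + a T, hence inside N by Nakayama, although e is in T. A t in T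
    outside N + a E leads to the prime. *)
Lemma ass_prime_step (E : lmodType A) (N : E -> Prop) a e :
  noeth_mod E -> subm N -> a \in M -> (forall f, N (a *: f) -> N f) -> ~ N e ->
  exists e', [/\ ~ (exists n f, N n /\ e' = n + a *: f),
     prime_ideal (to_pred (fun b => exists n f, N n /\ b *: e' = n + a *: f)) &
     forall b, N (b *: e) \/ b = a -> exists n f, N n /\ b *: e' = n + a *: f].
Proof.
move=> hE hN aM ha ne.
have [t Tt nt] : exists2 t, (forall b, N (b *: e) -> N (b *: t)) &
    ~ exists n f, N n /\ t = n + a *: f.
  apply: contrapT => hno; apply: ne.
  apply: (@nakayama _ hA M hM E N (fun t => forall b, N (b *: e) -> N (b *: t)) a) => //.
  move=> t Tt; have [n [f [Nn et]]] : exists n f, N n /\ t = n + a *: f.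
    by apply: contrapT => h; apply: hno; exists t.
  exists n, f; split=> // b /Tt Nbt; apply: ha.
  rewrite scalerA mulrC -scalerA (_ : a *: f = t - n); last by rewrite et addrC addKr.
  by rewrite scalerBr; apply: submB => //; exact: submZ.
have [e' [ne' h hp _]] := ass_prime hA (subm_span a hN) nt.
exists e'; split=> // b [/Tt hb|->]; apply: h.
  by exists (b *: t), 0; rewrite scaler0 addr0.
by exists 0, t; rewrite add0r; split=> //; exact: subm0.
Qed.

(** The inclusions are strict because s_i, a nonzerodivisor modulo the earlier entries, misses the
    annihilator prime of its stage, while [ass_prime_step] puts it into the next one. *)
Lemma regular_chain (E : lmodType A) s i k (e : E) :
  noeth_mod E -> regular_seq E s -> {subset s <= M} -> (i + k <= size s)%N ->
  ~ seq_mul (take i s) e -> prime_ideal (to_pred (fun a => seq_mul (take i s) (a *: e))) ->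
  exists p, prime_chain k p /\ p 0%N = to_pred (fun a => seq_mul (take i s) (a *: e)).
Proof.
move=> hE [_ hs] sM hik ne hP; set P := to_pred _.
suff [p [e' [hp p0 _ _]]] : exists p (e' : E), [/\ prime_chain k p, p 0%N = P,
    ~ seq_mul (take (i + k) s) e' & p k = to_pred (fun a => seq_mul (take (i + k) s) (a *: e'))].
  by exists p.
elim: k hik => [_|k IH hik].
  by exists (fun=> P), e; rewrite addn0; split=> //; split.
have [|p [e1 [hp p0 ne1 pk]]] := IH; first lia.
have hlt : (i + k < size s)%N by lia.
have zM : s`_(i + k) \in M by apply/sM/mem_nth.
have [|e2 [ne2 hQ he2]] := ass_prime_step hE (seq_mul_subm E (take (i + k) s)) zM _ ne1.
  by move=> f; exact: hs.
set Q : {pred A} := to_pred _ in hQ.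
have eQ : Q = to_pred (fun a => seq_mul (take (i + k).+1 s) (a *: e2)).
  by apply/funext => a; apply: asbool_equiv_eq; split=> /seq_mul_takeS; apply.
have [|h|q [hq eq lq]] := chain_snoc hp hQ.
- by move=> a; rewrite pk => /prP h; apply/prP/he2; left.
- have : s`_(i + k) \in p k by apply: h; apply/prP/he2; right.
  by rewrite pk => /prP/(hs _ hlt).
exists q, e2; rewrite (eq 0%N) // lq addnS; split=> //.
by move/(seq_mul_takeS _ hlt).
Qed.

(** This amounts to dim A/(s) + |s| <= dim A and will bound the dimension of the homology from
    above. *)
Lemma chain_below_regular s n p : regular_seq A^o s -> prime_chain n p ->
  (forall a, @seq_mul A A^o s a -> a \in p 0%N) ->
  exists q, prime_chain (n + size s) q.
Proof.
move=> [_ hs] hp hsp.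
suff gen k : (k <= size s)%N -> exists q, prime_chain (n + k) q /\
    forall a, @seq_mul A A^o (take (size s - k) s) a -> a \in q 0%N.
  by have [q [hq _]] := gen _ (leqnn _); exists q.
elim: k => [_|k IH hk].
  by exists p; rewrite addn0 subn0 take_size.
have [|q [hq Jq]] := IH; first lia.
set i := (size s - k.+1)%N; have hi : (i < size s)%N by rewrite /i; lia.
have ei : (size s - k = i.+1)%N by rewrite /i; lia.
rewrite ei in Jq.
have hq0 := proj1 hq 0%N (leq0n _).
have sub_i a : @seq_mul A A^o (take i s) a -> @seq_mul A A^o (take i.+1 s) a.
  by move=> ha; apply/seq_mul_takeS => //; exists a, 0; rewrite scaler0 addr0.
have zq : s`_i \in q 0%N.
  apply: Jq; apply/seq_mul_takeS => //; exists 0, 1; rewrite add0r [_ *: _]mulr1.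
  by split=> //; exact: subm0 (seq_mul_subm _ _).
(* A prime missing this multiplicative set lies inside q 0 and avoids s_i. The set misses (s_0, ...,
   s_{i-1}) because powers of s_i cancel modulo that ideal, which is inside q 0. *)
have [|| | a Ja|Q [hQ JQ QS]] := @prime_disjoint _ hA
    (fun w => exists k s0, s0 \notin q 0%N /\ w = s`_i ^+ k * s0)
    (@seq_mul A A^o (take i s)).
- by exists 0%N, 1; rewrite expr0 mulr1 prime1.
- move=> _ _ [a [u [hu ->]]] [b [v [hv ->]]]; exists (a + b)%N, (u * v).
  by rewrite primeM // exprD mulrACA.
- exact: seq_mul_subm.
- move=> [l [s0 [s0q ea]]]; move/negP: s0q; apply; apply/Jq/sub_i.
  move: Ja; rewrite ea; elim: l {ea} => [|l IHl]; first by rewrite mul1r.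
  by rewrite exprS -mulrA => /(hs _ hi).
have Qq : {subset Q <= q 0%N}.
  move=> a aQ; apply: contrapT => /negP aq; apply: (QS a aQ).
  by exists 0%N, a; rewrite mul1r.
have [|q' [hq' e0]] := chain_cons hq hQ Qq.
  move=> /(_ _ zq) /QS; apply; exists 1%N, 1.
  by rewrite mulr1 prime1.
by exists q'; rewrite addnS e0.
Qed.

(** An extension of s could also fail because (s, a)E = E; Nakayama excludes this. *)
Lemma maximal_zero_divisor (E : lmodType A) (J : {pred A}) s a :
  noeth_mod E -> {subset J <= M} -> maximal_regular_seq E J s -> a \in J ->
  exists2 e : E, ~ seq_mul s e & seq_mul s (a *: e).
Proof.
move=> hE JM [sJ hs maxs] aJ; apply: contrapT => hno.
apply: (maxs a aJ); apply: regular_rcons => //.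
  by move=> e he; apply: contrapT => ne; apply: hno; exists e.
apply: contrapT => hall.
have [[e ne] _] := hs; apply: ne.
apply: (@nakayama _ hA M hM E _ (fun=> True) a hE (seq_mul_subm E s)) => //; first exact: JM.
move=> t _; have /seq_mul_rcons[n [f [hn et]]] : seq_mul (rcons s a) t.
  by apply: contrapT => nt; apply: hall; exists t.
by exists n, f.
Qed.

Lemma regular_extend (E : lmodType A) (J : {pred A}) B s :
  (forall w, regular_seq E w -> {subset w <= J} -> (size w <= B)%N) ->
  regular_seq E s -> {subset s <= J} ->
  exists w, maximal_regular_seq E J (s ++ w).
Proof.
move=> hB; have [k] := ubnP (B - size s).
elim: k s => // k IH s hk hs sJ.
have [hmax|] := pselect (forall a, a \in J -> ~ regular_seq E (rcons s a)).
  by exists [::]; rewrite cats0.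
move=> /existsNP[a /not_implyP[aJ /contrapT ha]].
have sJ' : {subset rcons s a <= J}.
  by move=> b; rewrite mem_rcons inE => /orP[/eqP ->|/sJ].
have := hB _ ha sJ'; rewrite size_rcons => hsz.
have [|w hw] := IH (rcons s a) _ ha sJ'; first by rewrite size_rcons; lia.
by exists (a :: w); rewrite -cat_rcons.
Qed.

End LocalChains.
End Chains.

(** * The Koszul complex of a sequence, with coefficients *)

Section ListKoszul.
Variable A : comNzRingType.
Implicit Types (E U V W : lmodType A) (l : seq A) (S : A -> Prop).

Definition mklin U V (f : U -> V) (hf : linear f) : {linear U -> V} :=
  HB.pack f (GRing.isLinear.Build A U V _ f hf).

(* A pair (f', f'') in the complex of a :: l stands for f' + e_a /\ f''. *)
Fixpoint kos E l : lmodType A :=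
  if l is _ :: l' then (kos E l' * kos E l')%type else E.

Fixpoint kd E l : kos E l -> kos E l :=
  match l with
  | [::] => fun=> 0
  | a :: l' => fun f => (kd f.1 + a *: f.2, - kd f.2)
  end.

Fixpoint khom E l (i : nat) : kos E l -> Prop :=
  match l with
  | [::] => fun e => if i is 0%N then True else e = 0
  | a :: l' => fun f => khom i f.1 /\ if i is j.+1 then khom j f.2 else f.2 = 0
  end.

Fixpoint kmap U V (phi : U -> V) l : kos U l -> kos V l :=
  match l with
  | [::] => phi
  | a :: l' => fun f => (kmap phi f.1, kmap phi f.2)
  end.

(* wedge product with \sum_i u i * e_i *)
Fixpoint kwedge E l (u : nat -> A) : kos E l -> kos E l :=
  match l with
  | [::] => fun=> 0
  | a :: l' => fun f =>
    (kwedge (fun i => u i.+1) f.1, u 0%N *: f.1 - kwedge (fun i => u i.+1) f.2)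
  end.

Fixpoint ktop E l (e : E) : kos E l :=
  match l with
  | [::] => e
  | a :: l' => (0, ktop l' e)
  end.

Lemma pair_eq2 (T1 T2 : Type) (x x' : T1) (y y' : T2) :
  x = x' -> y = y' -> (x, y) = (x', y').
Proof. by move=> -> ->. Qed.

Lemma kd_is_linear E l : linear (@kd E l).
Proof.
elim: l => [|a l IH] c; first by move=> f g /=; rewrite scaler0 addr0.
move=> [f1 f2] [g1 g2] /=; apply: pair_eq2.
  rewrite -[RHS]/(c *: (kd f1 + a *: f2) + (kd g1 + a *: g2)).
  by rewrite !IH !scalerDr !scalerA [c * a]mulrC addrACA.
rewrite -[RHS]/(c *: (- kd f2) - kd g2).
by rewrite !IH opprD scalerN.
Qed.
HB.instance Definition _ E l :=
  GRing.isLinear.Build A (kos E l) (kos E l) _ (@kd E l) (@kd_is_linear E l).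

Lemma kmap_is_linear U V (phi : {linear U -> V}) l : linear (kmap phi (l:=l)).
Proof.
elim: l => [|a l IH] c f g /=; first by rewrite linearP.
by rewrite !IH.
Qed.
HB.instance Definition _ U V (phi : {linear U -> V}) l :=
  GRing.isLinear.Build A (kos U l) (kos V l) _ (kmap phi (l:=l))
    (@kmap_is_linear U V phi l).

Lemma kdd E l (f : kos E l) : kd (kd f) = 0.
Proof.
elim: l f => [//|a l IH] f /=.
apply: pair_eq2; first by rewrite linearD linearZ /= IH add0r scalerN subrr.
by rewrite linearN /= IH !oppr0.
Qed.

Lemma khom_subm E l i : subm (@khom E l i).
Proof.
elim: l i => [|a l IH] i /=.
  case: i => [|i]; first by split.
  by split=> // c u v -> ->; rewrite scaler0 addr0.
split.
  split; first exact: subm0 (IH i).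
  by case: i => [//|i]; exact: subm0 (IH i).
move=> c u v [hu1 hu2] [hv1 hv2]; split; first exact: (proj2 (IH i)).
case: i hu2 hv2 {hu1 hv1} => [/= -> ->|i hu hv]; last exact: (proj2 (IH i)).
by rewrite scaler0 addr0.
Qed.

Lemma kd_khom0 E l (f : kos E l) : khom 0 f -> kd f = 0.
Proof.
elim: l f => [//|b l IHl] g /= [h1 h2].
by rewrite h2 IHl // !linear0 add0r.
Qed.

Lemma khom_kd E l i (f : kos E l) : khom i.+1 f -> khom i (kd f).
Proof.
elim: l i f => [|a l IH] i f /=; first by case: i.
move=> [h1 h2]; split.
  apply: submD; first exact: khom_subm.
    exact: IH.
  by apply: submZ => //; exact: khom_subm.
case: i h1 h2 => [|i] h1 h2; last by apply: submN (IH _ _ _) => //; exact: khom_subm.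
by rewrite (kd_khom0 h2) oppr0.
Qed.

Lemma khom_gt_size E l i (f : kos E l) : (size l < i)%N -> khom i f -> f = 0.
Proof.
elim: l i f => [|a l IH] [//|i] f //=; rewrite ltnS => hi [h1 h2]; move: f h1 h2.
by case=> f1 f2 /= /(IH _ _ (ltnW _)) -> // /(IH _ _ hi) ->.
Qed.

Lemma kmap_kd U V (phi : {linear U -> V}) l (f : kos U l) :
  kmap phi (kd f) = kd (kmap phi f).
Proof.
elim: l f => [|a l IH] f /=; first by rewrite linear0.
by rewrite linearD linearZ linearN /= !IH.
Qed.

Lemma kmap_khom U V (phi : {linear U -> V}) l i (f : kos U l) :
  khom i f -> khom i (kmap phi f).
Proof.
elim: l i f => [|a l IH] i f /=.
  by case: i => [//|i ->]; rewrite linear0.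
move=> [h1 h2]; split; first exact: IH.
by case: i h2 {h1} => [->|i /IH//]; rewrite linear0.
Qed.

Lemma kmap_inj U V (phi : {linear U -> V}) l :
  injective phi -> injective (kmap phi (l:=l)).
Proof.
move=> hphi; elim: l => [//|a l IH] [f1 f2] [g1 g2] /= [] /IH -> /IH -> //.
Qed.

Lemma khom_kmap_inj U V (phi : {linear U -> V}) l i (f : kos U l) :
  injective phi -> khom i (kmap phi f) -> khom i f.
Proof.
move=> hphi; elim: l i f => [|a l IH] i f /=.
  by case: i => [//|i]; rewrite -[0](linear0 phi) => /hphi.
move=> [h1 h2]; split; first exact: IH.
case: i h2 {h1} => [|i /IH//].
by rewrite -[0](linear0 (kmap phi (l:=l))) => /kmap_inj; apply.
Qed.

Lemma kmap_lift V W (psi : {linear V -> W}) l i (w : kos W l) :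
  (forall w, exists v, psi v = w) -> khom i w ->
  exists v, khom i v /\ kmap psi v = w.
Proof.
move=> hpsi; elim: l i w => [|a l IH] i w /=.
  case: i => [|i]; first by have [v <-] := hpsi w; exists v.
  by move=> ->; exists 0; rewrite linear0.
case: w => w1 w2 /= [h1 h2].
have [v1 [hv1 <-]] := IH i w1 h1.
case: i h2 {h1} hv1 => [->|i /IH[v2 [hv2 <-]]] hv1; last by exists (v1, v2).
by exists (v1, 0) => /=; rewrite linear0.
Qed.

Lemma kmap_ker U V W (phi : {linear U -> V}) (psi : {linear V -> W}) l (v : kos V l) :
  (forall v, psi v = 0 -> exists u, phi u = v) -> kmap psi v = 0 ->
  exists u, kmap phi u = v.
Proof.
move=> hker; elim: l v => [|a l IH] v /=; first exact: hker.
case: v => v1 v2 /= [] /IH[u1 <-] /IH[u2 <-].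
by exists (u1, u2).
Qed.

Lemma kwedge_is_linear E l u : linear (@kwedge E l u).
Proof.
elim: l u => [|a l IH] u c; first by move=> f g /=; rewrite scaler0 addr0.
move=> [f1 f2] [g1 g2] /=; apply: pair_eq2; rewrite IH //.
rewrite -[RHS]/(c *: (u 0%N *: f1 - kwedge (fun i => u i.+1) f2)
  + (u 0%N *: g1 - kwedge (fun i => u i.+1) g2)).
by rewrite !scalerBr !scalerDr !scalerA [c * _]mulrC opprD addrACA.
Qed.
HB.instance Definition _ E l u :=
  GRing.isLinear.Build A (kos E l) (kos E l) _ (@kwedge E l u)
    (@kwedge_is_linear E l u).

Lemma khom_kwedge E l u i (f : kos E l) : khom i f -> khom i.+1 (kwedge u f).
Proof.
elim: l u i f => [//|a l IH] u i f /= [h1 h2]; split; first exact: IH.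
apply: submB; first exact: khom_subm.
  by apply: submZ => //; exact: khom_subm.
by case: i h2 {h1} => [->|i /IH//]; rewrite linear0; exact: subm0 (khom_subm _ _ _).
Qed.

(** This null-homotopy is why the ideal (l) kills the Koszul homology of l. *)
Lemma kwedge_homotopy E l u (f : kos E l) :
  kd (kwedge u f) + kwedge u (kd f) = (\sum_(i < size l) l`_i * u i) *: f.
Proof.
elim: l u f => [|a l IH] u; first by move=> f /=; rewrite big_ord0 scale0r addr0.
move=> [f1 f2]; rewrite big_ord_recl /=.
set c := \sum_(i < size l) _.
pose w : kos E l -> kos E l := kwedge (fun i => u i.+1).
have {}IH (g : kos E l) : w (kd g) = c *: g - kd (w g).
  have -> : c *: g = _ := esym (IH (fun i => u i.+1) g).
  by rewrite addrC addKr.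
have wD x y : w (x + y) = w x + w y by exact: linearD.
have wZ b x : w (b *: x) = b *: w x by exact: linearZ.
have wN x : w (- x) = - w x by exact: linearN.
have dB x y : kd (x - w y) = kd x - kd (w y) by exact: linearB.
have dZ b (x : kos E l) : kd (b *: x) = b *: kd x by exact: linearZ.
apply: pair_eq2.
  transitivity (kd (w f1) + a *: (u 0%N *: f1 - w f2) + w (kd f1 + a *: f2)) => //.
  transitivity ((a * u 0%N + c) *: f1); last by [].
  rewrite wD wZ IH scalerBr scalerA scalerDl addrACA subrK.
  by rewrite [kd (w f1) + _]addrC subrK addrC.
transitivity (- kd (u 0%N *: f1 - w f2) + (u 0%N *: (kd f1 + a *: f2) - w (- kd f2))) => //.
transitivity ((a * u 0%N + c) *: f2); last by [].
rewrite wN IH dB dZ scalerDr scalerA scalerDl [u _ * a]mulrC opprB opprK.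
by rewrite addrA [_ - _ + (_ + _)]addrA subrK addrC addrA subrK addrC.
Qed.

Lemma khom_ktop E l (e : E) : khom (size l) (ktop l e).
Proof.
elim: l => [//|a l IH] /=; split=> //; exact: subm0 (khom_subm _ _ _).
Qed.

Lemma ktop_inj0 E l (e : E) : ktop l e = 0 -> e = 0.
Proof. by elim: l => [//|a l IH] [] /IH. Qed.

Lemma ktopZ E l a (e : E) : ktop l (a *: e) = a *: ktop l e.
Proof. by elim: l => [//|b l IH] /=; rewrite IH; congr (_, _); rewrite scaler0. Qed.

Lemma kd_ktop E l (e : E) : (forall a, a \in l -> a *: e = 0) -> kd (ktop l e) = 0.
Proof.
elim: l => [//|a l IH] h /=.
rewrite linear0 -ktopZ h ?mem_head // add0r.
have -> : ktop l (0 : E) = 0 by rewrite -(scale0r 0) ktopZ scale0r.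
by rewrite IH ?oppr0 // => b bl; apply: h; rewrite inE bl orbT.
Qed.

Lemma noeth_mod_kos E l : noeth_mod E -> noeth_mod (kos E l).
Proof.
move=> hE; elim: l => [//|a l IH] /=.
have l1 : linear (fun u : kos E l => ((u, 0) : kos E l * kos E l)%type).
  move=> c u v; apply: pair_eq2 => //.
  by rewrite -[RHS]/(c *: (0 : kos E l) + 0) scaler0 addr0.
have l2 : linear (fun u : (kos E l * kos E l)%type => u.2) by [].
apply: (@noeth_mod_ext _ _ _ _ (mklin l1) (mklin l2)) => // -[u v] /= ->.
by exists u.
Qed.

(* H_i(l; E) is S-torsion. For S = {1} this says that H_i(l; E) = 0, and for S the
   complement of a prime ideal that H_i(l; E) vanishes locally at that prime. *)
Definition kos_torsion S l i E : Prop := forall f : kos E l, khom i f -> kd f = 0 ->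
  exists s g, [/\ S s, khom i.+1 g & kd g = s *: f].

(** * Torsion along long exact sequences *)

Section LongExact.
Variables (S : A -> Prop) (S1 : S 1) (SM : forall s t, S s -> S t -> S (s * t)).
Variable l : seq A.

Lemma kos_torsion_gt_size i E : (size l < i)%N -> kos_torsion S l i E.
Proof.
move=> hi f /(khom_gt_size hi) -> _; exists 1, 0.
by rewrite linear0 scaler0; split=> //; exact: subm0 (khom_subm _ _ _).
Qed.

(** Chase along H_i(V) -> H_i(W) -> H_{i-1}(U). For i = 0 the last term is absent, whence the
    guarded hypothesis on U. *)
Lemma kos_torsion_quot i U V W (phi : {linear U -> V}) (psi : {linear V -> W}) :
  injective phi -> (forall w, exists v, psi v = w) ->
  (forall v, psi v = 0 -> exists u, phi u = v) -> (forall u, psi (phi u) = 0) ->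
  kos_torsion S l i V -> (forall j, i = j.+1 -> kos_torsion S l j U) -> kos_torsion S l i W.
Proof.
move=> inj surj ker im hV hU w hw dw.
have [v [hv ew]] := kmap_lift surj hw; subst w.
(* The boundary of v comes from a cycle of U, and s times that cycle bounds in U; subtracting what
   it bounds turns s v into a cycle with the same image in W. *)
have [s [v' [Ss hv' dv' ev']]] : exists s v', [/\ S s, khom i v', kd v' = 0 &
    kmap psi v' = s *: kmap psi v].
  case: i hv hV hU {hw} => [|i] hv hV hU.
    by exists 1, v; rewrite scale1r kd_khom0.
  have [|u eu] := @kmap_ker _ _ _ phi psi l (kd v) ker; first by rewrite kmap_kd.
  have hu : khom i u by apply: khom_kmap_inj inj _; rewrite eu; exact: khom_kd.
  have du : kd u = 0.
    by apply: (kmap_inj inj); rewrite kmap_kd eu kdd linear0.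
  have [s [g [Ss hg dg]]] := hU i erefl u hu du.
  exists s, (s *: v - kmap phi g); split=> //.
  - apply: submB; [exact: khom_subm|apply: submZ => //; exact: khom_subm|].
    exact: kmap_khom.
  - by rewrite linearB linearZ /= -kmap_kd dg linearZ /= eu subrr.
  - rewrite linearB linearZ /= (_ : kmap psi (kmap phi g) = 0) ?subr0 //.
    elim: l {hg dg hv dw u eu hu du v} g => [|a l' IH] g /=; first exact: im.
    by rewrite !IH.
have [t [g [St hg dg]]] := hV v' hv' dv'.
exists (t * s), (kmap psi g); split; [exact: SM|exact: kmap_khom|].
by rewrite -kmap_kd dg linearZ /= ev' scalerA.
Qed.

(** Chase along H_{i+1}(W) -> H_i(U) -> H_i(V). *)
Lemma kos_torsion_sub i U V W (phi : {linear U -> V}) (psi : {linear V -> W}) :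
  injective phi -> (forall w, exists v, psi v = w) ->
  (forall v, psi v = 0 -> exists u, phi u = v) -> (forall u, psi (phi u) = 0) ->
  kos_torsion S l i V -> kos_torsion S l i.+1 W -> kos_torsion S l i U.
Proof.
move=> inj surj ker im hV hW u hu du.
have kim g : kmap psi (kmap phi g) = 0 :> kos W l.
  by elim: l g => [|a l' IH] g /=; [exact: im|rewrite !IH].
have [||s [v [Ss hv dv]]] := hV (kmap phi u); first exact: kmap_khom.
  by rewrite -kmap_kd du linear0.
have [||t [w [St hw dw]]] := hW (kmap psi v); first exact: kmap_khom.
  by rewrite -kmap_kd dv linearZ /= kim scaler0.
have [v' [hv' ev']] := kmap_lift surj hw; subst w.
have [|g eg] := @kmap_ker _ _ _ phi psi l (t *: v - kd v') ker.
  by rewrite linearB linearZ /= kmap_kd dw subrr.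
exists (t * s), g; split; first exact: SM.
  apply: khom_kmap_inj inj _; rewrite eg.
  apply: submB; [exact: khom_subm|apply: submZ => //; exact: khom_subm|].
  exact: khom_kd.
apply: (kmap_inj inj).
by rewrite kmap_kd eg linearB /= kdd subr0 2!linearZ /= dv scalerA.
Qed.

(** Multiplication by an element of (l) is zero on homology, so the connecting map H_{i+1}(W) ->
    H_i(E) is onto; [kwedge u f] is an explicit chain bounding phi f. *)
Lemma kos_torsion_mul i E W (phi : {linear E -> E}) (psi : {linear E -> W}) (u : nat -> A) :
  (forall e, phi e = (\sum_(i < size l) l`_i * u i) *: e) ->
  injective phi -> (forall w, exists v, psi v = w) ->
  (forall v, psi v = 0 -> exists u, phi u = v) -> (forall u, psi (phi u) = 0) ->
  kos_torsion S l i.+1 W -> kos_torsion S l i E.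
Proof.
move=> ea inj surj ker im hW f hf df.
have kim g : kmap psi (kmap phi g) = 0 :> kos W l.
  by elim: l g => [|a l' IH] g /=; [exact: im|rewrite !IH].
have dg : kd (kwedge u f) = kmap phi f.
  rewrite -[LHS]addr0 -(linear0 (@kwedge E l u)) -df kwedge_homotopy.
  move: (\sum_(i < _) _) ea => c ec; elim: l f {hf df} => [|b l' IH] f /=.
    by rewrite ec.
  by rewrite -!IH.
have [||s [w [Ss hw dw]]] := hW (kmap psi (kwedge u f)).
- exact/kmap_khom/khom_kwedge.
- by rewrite -kmap_kd dg kim.
have [v [hv ev]] := kmap_lift surj hw; subst w.
have [|h eh] := @kmap_ker _ _ _ phi psi l (s *: kwedge u f - kd v) ker.
  by rewrite linearB linearZ /= kmap_kd dw subrr.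
exists s, h; split=> //.
  apply: khom_kmap_inj inj _; rewrite eh.
  apply: submB; [exact: khom_subm| |exact: khom_kd].
  by apply: submZ; [exact: khom_subm|exact: khom_kwedge].
apply: (kmap_inj inj).
by rewrite kmap_kd eh linearB linearZ /= kdd subr0 dg linearZ.
Qed.

(** In top degree there are no boundaries, and an element of E killed by l is a cycle there. *)
Lemma kos_torsion_top E (e : E) : kos_torsion S l (size l) E -> (forall a, a \in l -> a *: e = 0) ->
  exists s, S s /\ s *: e = 0.
Proof.
move=> hE he; have [|| s [g [Ss hg]]] := hE (ktop l e).
- exact: khom_ktop.
- exact: kd_ktop.
rewrite (khom_gt_size _ hg) // linear0 -ktopZ => /esym/ktop_inj0 h.
by exists s.
Qed.

End LongExact.

(** Torsion of H_i for a :: l makes multiplication by a onto on H_i(l), up to factors outside P, so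
    H_i(l) is torsion by Nakayama. By induction H_{i+1}(l) is torsion too, and these two enclose
    H_{i+1} for a :: l. *)
Lemma kos_torsion_rigid (P : {pred A}) l i E : prime_ideal P -> noeth_mod E ->
  {subset l <= P} -> kos_torsion (fun s => s \notin P) l i E ->
  kos_torsion (fun s => s \notin P) l i.+1 E.
Proof.
move=> hP hE; elim: l i => [|a l IH] i lP hnull.
  by move=> f /= -> _; exists 1, 0; rewrite scaler0; split=> //; exact: prime1.
have aP : a \in P by apply: lP; rewrite mem_head.
have lP' : {subset l <= P} by move=> b bl; apply: lP; rewrite inE bl orbT.
have hnull' : kos_torsion (fun s => s \notin P) l i E.
  move=> f hf df.
  pose N g := exists2 h : kos E l, khom i.+1 h & kd h = g.
  pose T (g : kos E l) := khom i g /\ kd g = 0.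
  have hN : subm N.
    split; first by exists 0; [exact: subm0 (khom_subm _ _ _)|rewrite linear0].
    move=> c _ _ [u hu <-] [v hv <-]; exists (c *: u + v); last by rewrite linearP.
    exact: (proj2 (khom_subm _ _ _)).
  have [|s sP [g hg dg]] := @nakayama_at _ P (kos E l) N T a hP (@noeth_mod_kos E l hE)
      hN aP _ f (conj hf df); last by exists s, g.
  move=> t [ht dt].
  (* The bounding pair says s t = kd g1 + a g2 with g2 a cycle. *)
  have [||s [[g1 g2] [sP [/= hg1 hg2] [dg1 dg2]]]] := hnull (t, 0).
  - split=> //=; case: i {hnull N hN T hf ht} => [//|i]; exact: subm0 (khom_subm _ _ _).
  - by rewrite /= dt !linear0 addr0.
  exists s, (kd g1), g2; split=> //; first by exists g1.
  split=> //; apply: oppr_inj; rewrite dg2 oppr0.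
  exact: (@scaler0 A (kos E l) s).
have {}IH := IH i lP' hnull'.
move=> [f1 f2] /= [hf1 hf2] [df1 /eqP]; rewrite oppr_eq0 => /eqP df2.
have [s [g [sP hg dg]]] := hnull' f2 hf2 df2.
have [||t [h [tP hh dh]]] := IH (s *: f1 + a *: g).
- apply: submD; first exact: khom_subm.
    by apply: submZ => //; exact: khom_subm.
  by apply: submZ => //; exact: khom_subm.
- rewrite linearD !linearZ /= dg scalerA mulrC -scalerA -scalerDr df1.
  exact: scaler0.
exists (t * s), (h, - (t *: g)); split; first exact: primeM.
  split=> //; apply: submN; first exact: khom_subm.
  by apply: submZ => //; exact: khom_subm.
apply: pair_eq2 => /=.
  transitivity ((t * s) *: f1); last by [].
  by rewrite dh scalerN scalerDr !scalerA [a * t]mulrC addrK.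
transitivity ((t * s) *: f2); last by [].
by rewrite linearN linearZ /= dg opprK scalerA.
Qed.

(** The identity of E factors through finitely many copies of F, so cycles can be bounded component
    by component. This will give the free modules K_i the depth of A. *)
Lemma kos_torsion_retract l i E (F : lmodType A) (T : finType) (iota : T -> {linear F -> E})
    (p : T -> {linear E -> F}) :
  (forall e, e = \sum_(k : T) iota k (p k e)) ->
  kos_torsion (fun s => s = 1) l i F -> kos_torsion (fun s => s = 1) l i E.
Proof.
move=> hE hF f hf df.
have /choice[g hg] k : exists g : kos F l, khom i.+1 g /\ kd g = kmap (p k) f.
  have [||s [g [-> hg dg]]] := hF (kmap (p k) f).
  - exact: kmap_khom.
  - by rewrite -kmap_kd df linear0.
  by exists g; rewrite dg scale1r.
exists 1, (\sum_k kmap (iota k) (g k)); split=> //.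
  apply: (big_ind (fun h => khom i.+1 h)).
  - exact: subm0 (khom_subm _ _ _).
  - by move=> u v; apply: submD; exact: khom_subm.
  - by move=> k _; apply: kmap_khom; case: (hg k).
rewrite scale1r linear_sum /=.
under eq_bigr => k _ do rewrite -kmap_kd (proj2 (hg k)).
elim: l f {hF hf df g hg} => [|a l IH] /=; first by move=> f; rewrite -hE.
move=> [f1 f2] /=; rewrite -[in RHS](IH f1) -[in RHS](IH f2).
apply: (big_rec3 (fun (x y : kos E l) (z : kos E (a :: l)) => z = (x, y))) => //.
by move=> k x y _ _ ->.
Qed.

End ListKoszul.

(** * Depth *)

Section Quotients.
Variable A : comNzRingType.
Implicit Types (E Q : lmodType A).

Lemma quotmod_pi E (W : submodClosed E) : exists pi : {linear E -> quotmod W},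
  (forall q, exists e, pi e = q) /\ (forall e, pi e = 0 <-> e \in W).
Proof.
have hpi : linear (fun e : E => \pi_(Quotient.quot (submod_pred W))%qT e : quotmod W).
  move=> a u v; rewrite raddfD /=; congr (_ + _).
  exact: pi_scale.
exists (mklin hpi); split=> [q|e].
  by exists (repr q); exact: reprK.
have /= := Quotient.idealrBE (submod_pred W) e 0.
rewrite subr0 => ->; split=> [h|/eqP h].
  by apply/eqP; rewrite raddf0.
by rewrite -[RHS](raddf0 (\pi_(Quotient.quot (submod_pred W))%qT)).
Qed.

Lemma quot_exists E (N : E -> Prop) : subm N ->
  exists (Q : lmodType A) (pi : {linear E -> Q}),
    (forall q, exists e, pi e = q) /\ (forall e, pi e = 0 <-> N e).
Proof.
move=> hN.
pose P : {pred E} := fun e => `[< N e >].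
have hP : submod_closed P.
  split; first exact/asboolP/(subm0 hN).
  by move=> a u v /asboolP hu /asboolP hv; apply/asboolP/(proj2 hN).
pose W : submodClosed E := HB.pack P (GRing.isSubmodClosed.Build A E P hP).
have [pi [h1 h2]] := quotmod_pi W.
exists (quotmod W), pi; split=> // e; rewrite h2; split=> [/asboolP|?] //.
exact/asboolP.
Qed.

Lemma scale_linear E (a : A) : linear (fun e : E => a *: e).
Proof. by move=> c u v; rewrite scalerDr !scalerA mulrC. Qed.

End Quotients.

Section RegularNull.
Variables (A : comNzRingType) (l : seq A).
Implicit Types (E Q : lmodType A) (s : seq A).

(** The quotient E / (s_0, ..., s_{i-1})E is represented by any surjection pi with that kernel, so
    that inductions along s can divide Q itself by s_i. *)
Lemma quot_next E s i Q (pi : {linear E -> Q}) : (i < size s)%N ->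
  (forall q, exists e, pi e = q) -> (forall e, pi e = 0 <-> seq_mul (take i s) e) ->
  exists (Q' : lmodType A) (psi : {linear Q -> Q'}),
    [/\ forall q, exists e, psi e = q, forall q, psi q = 0 <-> exists u, s`_i *: u = q &
      forall e, psi (pi e) = 0 <-> seq_mul (take i.+1 s) e].
Proof.
move=> hi psurj pker.
have hN : subm (fun q : Q => exists u, s`_i *: u = q).
  split; first by exists 0; rewrite scaler0.
  move=> c _ _ [u <-] [v <-]; exists (c *: u + v).
  by rewrite scalerDr !scalerA mulrC.
have [Q' [psi [surj ker]]] := quot_exists hN.
exists Q', psi; split=> // e; rewrite ker seq_mul_takeS //.
split=> [[u]|[n [f [hn ->]]]]; last first.
  by exists (pi f); rewrite linearD linearZ /= (proj2 (pker n)) // add0r.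
have [f <-] := psurj u => ef.
exists (e - s`_i *: f), f; rewrite subrK; split=> //.
by apply/pker; rewrite linearB linearZ /= ef subrr.
Qed.

Lemma regular_scale_inj E s i Q (pi : {linear E -> Q}) : regular_seq E s ->
  (i < size s)%N -> (forall q, exists e, pi e = q) ->
  (forall e, pi e = 0 <-> seq_mul (take i s) e) ->
  injective (fun q : Q => s`_i *: q).
Proof.
move=> [_ hs] hi psurj pker u v huv; apply/eqP; rewrite -subr_eq0; apply/eqP.
have [e he] := psurj (u - v); rewrite -he; apply/pker/(hs _ hi)/pker.
by rewrite linearZ /= he scalerBr huv subrr.
Qed.

(** By [kos_torsion_mul], undoing the division by one entry of s extends the vanishing range one
    degree downwards; the last quotient starts with the degrees above [size l]. *)
Lemma regular_null E s j : regular_seq E s ->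
  (forall a, a \in s -> exists u : nat -> A, a = \sum_(i < size l) l`_i * u i) ->
  (size l < j + size s)%N -> kos_torsion (fun t => t = 1) l j E.
Proof.
move=> hs sl hj.
suff gen k i Q (pi : {linear E -> Q}) : (i + k)%N = size s ->
    (forall q, exists e, pi e = q) ->
    (forall e, pi e = 0 <-> seq_mul (take i s) e) ->
    forall j, (size l < j + k)%N -> kos_torsion (fun t => t = 1) l j Q.
  have idl : linear (@id E) by [].
  apply: (gen (size s) 0%N E (mklin idl)) hj => //; first by move=> e; exists e.
  by move=> e; rewrite take0 seq_mul_nil.
elim: k i Q pi {j hj} => [|k IH] i Q pi hik psurj pker j hj.
  by apply: kos_torsion_gt_size => //; rewrite addn0 in hj.
have hi : (i < size s)%N by lia.
have [Q' [psi [surj ker kerpi]]] := quot_next hi psurj pker.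
have [u hu] := sl _ (mem_nth 0 hi).
apply: (@kos_torsion_mul A _ l j Q Q' (mklin (@scale_linear A Q s`_i)) psi u) => //=.
- by move=> e; rewrite -hu.
- exact: regular_scale_inj pker.
- by move=> v /ker.
- by move=> v; apply/ker; exists v.
have cl : linear (psi \o pi) by exact: linearP.
apply: (IH i.+1 Q' (mklin cl)) => //=; try lia.
by move=> q; have [v <-] := surj q; have [e <-] := psurj v; exists e.
Qed.

(** Dividing by one entry of s costs one degree of the torsion range, so top homology of E / (s)E is
    still torsion, and the class of e lives there. Used with S = {1} for depth and with the
    complement of P for survival at P. *)
Lemma kos_torsion_regular_top (S : A -> Prop) E s (e : E) : S 1 ->
  (forall a b, S a -> S b -> S (a * b)) -> regular_seq E s ->
  (forall j, (size l <= j + size s)%N -> kos_torsion S l j E) ->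
  (forall a, a \in l -> seq_mul s (a *: e)) -> exists t, S t /\ seq_mul s (t *: e).
Proof.
move=> S1 SM hs hnull he.
suff gen i : (i <= size s)%N -> exists (Q : lmodType A) (pi : {linear E -> Q}),
    [/\ forall q, exists e, pi e = q, forall e, pi e = 0 <-> seq_mul (take i s) e &
    forall j, (size l + i <= j + size s)%N -> kos_torsion S l j Q].
  have [Q [pi [psurj pker hQ]]] := gen _ (leqnn _); rewrite take_size in pker.
  have [||t [St ht]] := @kos_torsion_top _ S l Q (pi e).
  - exact: hQ.
  - by move=> a al; rewrite -linearZ_LR; apply/pker/he.
  by exists t; split=> //; apply/pker; rewrite linearZ.
elim: i => [_|i IH hi].
  have idl : linear (@id E) by [].
  exists E, (mklin idl); split=> [q|e'|j]; first by exists q.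
    by rewrite take0 seq_mul_nil.
  by rewrite addn0; exact: hnull.
have [Q [pi [psurj pker hQ]]] := IH (ltnW hi).
have [Q' [psi [surj ker kerpi]]] := quot_next hi psurj pker.
have cl : linear (psi \o pi) by exact: linearP.
exists Q', (mklin cl); split=> //=.
  by move=> q; have [v <-] := surj q; have [e' <-] := psurj v; exists e'.
move=> j hj.
apply: (@kos_torsion_quot _ S S1 SM l j Q Q Q' (mklin (@scale_linear A Q s`_i)) psi) => //=.
- exact: regular_scale_inj pker.
- by move=> v /ker.
- by move=> v; apply/ker; exists v.
- by apply: hQ; lia.
- by move=> j' ej; apply: hQ; lia.
Qed.

End RegularNull.

Section Depth.
Variables (A : comNzRingType) (M : {pred A}).
Hypotheses (hA : noetherian A) (hM : local_ring M).
Variable z : seq A.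
Hypotheses (zM : {subset z <= M}) (Mz : forall a, a \in M -> @seq_mul A A^o z a).
Implicit Types E U V W : lmodType A.

(* depth E >= k, as z generates the maximal ideal; true for every k if E = 0. *)
Definition depth_ge k E : Prop :=
  forall j, (size z < j + k)%N -> kos_torsion (fun t => t = 1) z j E.

Lemma depth_geW k k' E : (k' <= k)%N -> depth_ge k E -> depth_ge k' E.
Proof. by move=> hk h j hj; apply: h; lia. Qed.

Lemma seq_mul_sum (a : A) : @seq_mul A A^o z a ->
  exists u : nat -> A, a = \sum_(i < size z) z`_i * u i.
Proof. by move=> [u ->]; exists u. Qed.

Lemma regular_depth_ge E s : regular_seq E s -> {subset s <= M} -> depth_ge (size s) E.
Proof.
move=> hs sM j hj; apply: regular_null hj => // a /sM/Mz.
exact: seq_mul_sum.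
Qed.

(** By maximality some e outside (s)E is killed by M modulo (s)E; if size s < k, the top homology of
    E / (s)E vanishes, and the class of e with it. *)
Lemma depth_ge_maximal_regular k E s : noeth_mod E -> maximal_regular_seq E M s ->
  depth_ge k E -> (k <= size s)%N.
Proof.
move=> hE hs hk; rewrite leqNgt; apply/negP => lt.
have [|e ne he] := zero_divisors_common hA hE (seq_mul_subm E s)
    (prime_subm (maximal_prime hA hM)).
  by move=> a; exact: (maximal_zero_divisor hA hM hE (fun _ => id) hs).
have [||||| t [-> ht]] := @kos_torsion_regular_top _ z (fun t => t = 1) E s e.
- by [].
- by move=> a b -> ->; rewrite mulr1.
- by case: hs.
- by move=> j hj; apply: hk; lia.
- by move=> a /zM/he.
by apply: ne; rewrite -[e]scale1r.
Qed.

(** An associated prime of E starts a chain of length [size s]. The bound lets regular sequences be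
    completed to maximal ones, so that [grade] is attained for nonzero E. *)
Lemma regular_size_bound E s : noeth_mod E -> regular_seq E s -> {subset s <= M} ->
  (size s <= size z)%N.
Proof.
move=> hE hs sM; have [[e0 ne0] _] := hs.
have ne0' : ~ seq_mul (take 0 s) e0.
  rewrite take0 => /seq_mul_nil e00; apply: ne0; rewrite e00.
  exact: subm0 (seq_mul_subm _ _).
have [e [ne _ hP _]] := ass_prime hA (seq_mul_subm E (take 0 s)) ne0'.
have [|p [hp _]] := @regular_chain _ hA M hM E s 0 (size s) e hE hs sM _ ne hP.
  by [].
apply: (@chain_bound _ hA M hM z zM Mz (size z) 0 _ p) => // a.
rewrite take0 => /seq_mul_nil ->; exact: subm0 (prime_subm (proj1 hp _ (leq0n _))).
Qed.

Lemma regular_maximal E (J : {pred A}) s : noeth_mod E -> {subset J <= M} ->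
  regular_seq E s -> {subset s <= J} -> exists w, maximal_regular_seq E J (s ++ w).
Proof.
move=> hE JM; apply: (@regular_extend _ E J (size z)) => w hw wJ.
by apply: regular_size_bound hw _ => // a /wJ/JM.
Qed.

Lemma maximal_exists E (J : {pred A}) : noeth_mod E -> {subset J <= M} ->
  (exists e : E, e <> 0) -> exists s, maximal_regular_seq E J s.
Proof.
move=> hE JM [e ne]; have [||w hw] := @regular_maximal E J [::] hE JM; last by exists w.
  by split=> //; exists e => /seq_mul_nil.
by [].
Qed.

Lemma grade_maximal E (J : {pred A}) : noeth_mod E -> {subset J <= M} ->
  (exists e : E, e <> 0) -> exists2 s, maximal_regular_seq E J s & size s = grade E J.
Proof.
move=> hE JM ne; have [s hs] := maximal_exists hE JM ne.
apply: (@xgetPex _ 0%N [set n | exists2 s, maximal_regular_seq E J s & size s = n]%classic).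
by exists (size s), s.
Qed.

Lemma depth_ge_depth E : noeth_mod E -> (exists e : E, e <> 0) -> depth_ge (depth E M) E.
Proof.
move=> hE ne; rewrite /depth; have [s [sM hs _] <-] := @grade_maximal E M hE (fun _ => id) ne.
exact: regular_depth_ge.
Qed.

Lemma depth_ge_le_depth k E : noeth_mod E -> (exists e : E, e <> 0) -> depth_ge k E ->
  (k <= depth E M)%N.
Proof.
move=> hE ne; rewrite /depth; have [s hs <-] := @grade_maximal E M hE (fun _ => id) ne.
exact: depth_ge_maximal_regular.
Qed.

Lemma depth_ge_quot k U V W (phi : {linear U -> V}) (psi : {linear V -> W}) :
  injective phi -> (forall w, exists v, psi v = w) ->
  (forall v, psi v = 0 -> exists u, phi u = v) -> (forall u, psi (phi u) = 0) ->
  depth_ge k.+1 U -> depth_ge k V -> depth_ge k W.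
Proof.
move=> h1 h2 h3 h4 hU hV j hj; apply: (kos_torsion_quot _ _ h1 h2 h3 h4) => //.
- by move=> a b -> ->; rewrite mulr1.
- exact: hV.
- by move=> i ei; apply: hU; lia.
Qed.

Lemma depth_ge_sub k U V W (phi : {linear U -> V}) (psi : {linear V -> W}) :
  injective phi -> (forall w, exists v, psi v = w) ->
  (forall v, psi v = 0 -> exists u, phi u = v) -> (forall u, psi (phi u) = 0) ->
  depth_ge k.+1 V -> depth_ge k W -> depth_ge k.+1 U.
Proof.
move=> h1 h2 h3 h4 hV hW j hj; apply: (kos_torsion_sub _ h1 h2 h3 h4) => //.
- by move=> a b -> ->; rewrite mulr1.
- exact: hV.
- by apply: hW; lia.
Qed.

Section KrullDim.
Implicit Types J : {pred A}.

Lemma chain_le n (p : nat -> {pred A}) : prime_chain n p -> (n <= size z)%N.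
Proof.
move=> hp; apply: (@chain_bound _ hA M hM z zM Mz (size z) 0 _ p) => // a.
rewrite take0 => /seq_mul_nil ->; exact: subm0 (prime_subm (proj1 hp _ (leq0n _))).
Qed.

Lemma krull_dim_max J n : chain_above J n ->
  chain_above J (krull_dim J) /\ forall k, chain_above J k -> (k <= krull_dim J)%N.
Proof.
move=> hn.
have ex : exists k, `[< chain_above J k >] by exists n; exact/asboolP.
have ub k : `[< chain_above J k >] -> (k <= size z)%N.
  by move=> /asboolP[p [hp _]]; exact: chain_le hp.
case: (ex_maxnP ex ub) => d /asboolP hd maxd.
apply: (@xgetPex _ 0%N [set n | chain_above J n /\
   forall k, chain_above J k -> (k <= n)%N]%classic).
by exists d; split=> // k /asboolP/maxd.
Qed.

Lemma krull_dim_ge J n : chain_above J n -> (n <= krull_dim J)%N.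
Proof. by move=> h; have [_] := krull_dim_max h; apply. Qed.

Lemma krull_dim_le J B : (forall n, chain_above J n -> (n <= B)%N) ->
  (krull_dim J <= B)%N.
Proof.
move=> h; have [[n /krull_dim_max[/h //]]|no] := pselect (exists n, chain_above J n).
(* Without any chain above J the dimension is the default 0. *)
by rewrite /krull_dim xgetPN // => n [hn _]; apply: no; exists n.
Qed.

End KrullDim.

End Depth.

Lemma regular_system (A : comNzRingType) (M : {pred A}) : regular_local_ring M ->
  exists z : seq A, [/\ {subset z <= M}, forall a, a \in M -> @seq_mul A A^o z a &
    regular_seq A^o z].
Proof.
move=> [hA hM muM]; have hiM : idealr_closed M by case: hM => -[].
have [[x hx] _] : (exists x : 'I_(mu M) -> A, generates x M) /\
    forall k, (exists x : 'I_k -> A, generates x M) -> (mu M <= k)%N.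
  apply: (@xgetPex _ 0%N [set n | (exists x : 'I_n -> A, generates x M) /\
     forall k, (exists x : 'I_k -> A, generates x M) -> (n <= k)%N]%classic).
  have ex : exists n, `[< exists x : 'I_n -> A, generates x M >].
    by have [n hn] := hA M hiM; exists n; exact/asboolP.
  case: (ex_minnP ex) => n /asboolP hn minn; exists n; split=> // k hk.
  by apply: minn; exact/asboolP.
pose z := [seq x i | i <- enum 'I_(mu M)].
have sz : size z = mu M by rewrite size_map size_enum_ord.
have Mz a : a \in M -> @seq_mul A A^o z a by move=> /hx ha; exact/seq_mul_codom.
have zM : {subset z <= M}.
  move=> _ /mapP[i _ ->]; apply/hx; exists (fun j => (j == i)%:R).
  by rewrite (bigD1 i) //= eqxx mul1r big1 ?addr0 // => j /negPf ->; rewrite mul0r.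
exists z; split=> //.
(* The one-term chain M makes the set of lengths nonempty, so the dimension is attained by a chain,
   of length mu(M) = [size z]. *)
have h0 : chain_above (pred1 (0 : A)) 0.
  exists (fun=> M); split; last by move=> _ /eqP ->; case: hiM.
  by split=> // i _; exact: maximal_prime.
have [[p [hp _]] _] := krull_dim_max hA hM zM Mz h0.
apply: (generators_regular hA hM zM Mz (p := p)).
by rewrite sz muM.
Qed.

(** * Comparison with the exterior algebra *)

Section Comparison.
Variables (A : comNzRingType) (n : nat) (x : 'I_n -> A).
Implicit Types (j k : 'I_n) (js : seq 'I_n) (h : koszul A n) (T : {set 'I_n}).

(** This is e_j /\ h when j precedes every index occurring in h, whence no sign. *)
Definition kext j h : koszul A n :=
  [ffun T : {set 'I_n} => if j \in T then h (T :\ j) else 0].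

Lemma kext_is_linear j : linear (kext j).
Proof.
move=> a f g; apply/ffunP => T; rewrite !ffunE.
by case: ifP => _; rewrite ?ffunE // scaler0 addr0.
Qed.
HB.instance Definition _ j :=
  GRing.isLinear.Build A (koszul A n) (koszul A n) _ (kext j) (kext_is_linear j).

Lemma koszul_d_kext j h : (forall T, h T != 0 -> forall k, k \in T -> (j < k)%N) ->
  koszul_d x (kext j h) = x j *: h - kext j (koszul_d x h).
Proof.
move=> hj; apply/ffunP => T; rewrite !ffunE.
have h0 (S : {set 'I_n}) : j \in S -> h S = 0.
  move=> jS; apply/eqP; apply: contraT => /hj/(_ j jS); by rewrite ltnn.
case: ifPn => jT.
  rewrite (h0 T jT) scaler0 sub0r [in RHS](bigD1 j) ?inE ?eqxx //=.
  rewrite (h0 (j |: T :\ j)) ?inE ?eqxx // mulr0 add0r -sumrN.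
  rewrite (eq_bigl (fun k => (k \notin T :\ j) && (k != j))); last first.
    by move=> k; rewrite !inE negb_and negbK; case: (eqVneq k j) => [->|] //=; rewrite ?jT ?andbT.
  apply: eq_bigr => k /andP[kT kj]; rewrite ffunE !inE jT orbT.
  have -> : (k |: T) :\ j = k |: (T :\ j).
    by apply/setP=> l; rewrite !inE; case: (eqVneq l k) => [->|] //=; rewrite kj.
  have [->|hne] := eqVneq (h (k |: T :\ j)) 0; first by rewrite !mulr0 oppr0.
  have jk : (j < k)%N by apply: (hj _ hne); rewrite !inE eqxx.
  rewrite -!mulNr; congr (_ * _ * _); rewrite /koszul_sign.
  (* The extra smaller index j is the source of the minus sign before [kext j]. *)
  have -> : [set l in T | (l < k)%N] = j |: [set l in T :\ j | (l < k)%N].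
    by apply/setP=> l; rewrite !inE; case: (eqVneq l j) => [->|] //=; rewrite jT jk.
  by rewrite cardsU1 !inE eqxx /= add1n exprS mulN1r.
rewrite (bigD1 j) //= ffunE setU11 setU1K // big1 ?addr0 => [|k /andP[kT kj]].
  rewrite subr0; have [->|hne] := eqVneq (h T) 0; first by rewrite mulr0 scaler0.
  rewrite /koszul_sign (_ : [set _ in T | _] = finset.set0) ?cards0 ?expr0 ?mul1r //.
  apply/setP=> l; rewrite !inE; apply/negP => /andP[lT].
  by rewrite ltnNge ltnW // (hj T hne).
by rewrite ffunE !inE (negPf jT) eq_sym (negPf kj) mulr0.
Qed.

(** The recursion needs all sublists js of the index list; when js is increasing, its head precedes
    the indices of the tail, as [kext] requires. *)
Fixpoint kphi js : kos A^o [seq x j | j <- js] -> koszul A n :=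
  match js with
  | [::] => fun e => [ffun T : {set 'I_n} => if T == finset.set0 then e else 0]
  | j :: js' => fun f => kphi f.1 + kext j (kphi f.2)
  end.

Lemma kphi_is_linear js : linear (@kphi js).
Proof.
elim: js => [|j js IH] a.
  by move=> f g; apply/ffunP => T; rewrite !ffunE; case: ifP => // _; rewrite scaler0 addr0.
by move=> [f1 f2] [g1 g2] /=; rewrite !IH linearP scalerDr addrACA.
Qed.
HB.instance Definition _ js :=
  GRing.isLinear.Build A (kos A^o [seq x j | j <- js]) (koszul A n) _ (@kphi js)
    (@kphi_is_linear js).

Lemma kphi_supp js (f : kos A^o [seq x j | j <- js]) T :
  kphi f T != 0 -> forall k, k \in T -> k \in js.
Proof.
elim: js f T => [|j js IH] f T /=.
  by rewrite ffunE; case: ifP => [/eqP -> _ k|]; rewrite ?inE ?eqxx.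
case: f => f1 f2 /=; rewrite !ffunE => hT k kT; rewrite inE.
have [//|kj] /= := eqVneq k j.
have [h1|h1] := eqVneq (kphi f1 T) 0; last exact: IH h1 _ kT.
move: hT; rewrite h1 add0r; case: ifP => [_ /IH|]; last by rewrite eqxx.
by apply; rewrite !inE kj.
Qed.

Lemma kphi_kd js (f : kos A^o [seq x j | j <- js]) :
  sorted (fun i j : 'I_n => (i < j)%N) js -> koszul_d x (kphi f) = kphi (kd f).
Proof.
elim: js f => [|j js IH] f.
  move=> _; apply/ffunP => T; rewrite !ffunE /= if_same big1 // => k kT.
  rewrite ffunE; case: ifP; rewrite ?mulr0 // => /eqP/setP/(_ k).
  by rewrite !inE eqxx.
case: f => f1 f2 /= hs.
have hs' := path_sorted hs.
have hmin : all (fun k : 'I_n => (j < k)%N) js.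
  by apply: order_path_min hs => a b c; exact: ltn_trans.
rewrite linearD /= IH // koszul_d_kext; last first.
  by move=> T /kphi_supp hT k /hT; move/allP: hmin; apply.
by rewrite IH // linearD linearZ linearN /= linearN addrA.
Qed.

Lemma kphi_inj js : uniq js -> injective (@kphi js).
Proof.
move=> hu; suff ker f : @kphi js f = 0 -> f = 0.
  move=> f g /eqP; rewrite -subr_eq0 -linearB => /eqP/ker/eqP.
  by rewrite subr_eq0 => /eqP.
elim: js hu f => [_ f|j js IH] /=.
  by move=> /ffunP/(_ finset.set0); rewrite !ffunE eqxx.
move=> /andP[jjs hu] [f1 f2] /= h.
have hsupp (f : kos A^o [seq x j | j <- js]) T : j \in T -> kphi f T = 0.
  move=> jT; apply/eqP; apply: contraT => /kphi_supp/(_ j jT) jin.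
  by rewrite jin in jjs.
have -> : f2 = 0.
  apply: (IH hu); apply/ffunP => T; rewrite [RHS]ffunE.
  have [jT|jT] := boolP (j \in T); first exact: hsupp.
  move/ffunP: h => /(_ (j |: T)); rewrite !ffunE setU11 setU1K //.
  by rewrite (hsupp f1) ?setU11 // add0r.
have -> : f1 = 0 => //.
apply: (IH hu); apply/ffunP => T; rewrite [RHS]ffunE.
have [jT|jT] := boolP (j \in T); first exact: hsupp.
by move/ffunP: h => /(_ T); rewrite !ffunE (negPf jT) addr0.
Qed.

Lemma kphi_surj js i (h : koszul A n) : uniq js -> homogeneous i h ->
  (forall T, h T != 0 -> forall k, k \in T -> k \in js) ->
  exists f, khom i f /\ @kphi js f = h.
Proof.
move=> hu /homogeneousP; elim: js i h hu => [|j js IH] i h hu hh hs.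
  exists (h finset.set0); split.
    case: i hh => [//|i] hh; apply/eqP; apply: contraT => /hh.
    by rewrite cards0.
  apply/ffunP => T; rewrite ffunE; case: ifPn => [/eqP -> //|/finset.set0Pn[k kT]].
  by apply/esym/eqP; apply: contraT => /hs/(_ k kT).
move: hu => /= /andP[jjs hu].
(* Splits h as h1 + e_j /\ h2, with j absent from both h1 and h2. *)
pose h1 : koszul A n := [ffun T : {set 'I_n} => if j \in T then 0 else h T].
pose h2 : koszul A n := [ffun T : {set 'I_n} => if j \in T then 0 else h (j |: T)].
have [||f1 [hf1 ef1]] := IH i h1 hu.
- by move=> T; rewrite ffunE; case: ifP; rewrite ?eqxx // => _ /hh.
- move=> T; rewrite ffunE; case: ifPn; rewrite ?eqxx // => jT /hs hT k kT.
  by move: (hT k kT); rewrite inE => /orP[/eqP ej|//]; rewrite -ej kT in jT.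
have h2s T : h2 T != 0 -> (j \notin T) /\ h (j |: T) != 0.
  by rewrite ffunE; case: ifP; rewrite ?eqxx.
have [f2 [hf2 ef2]] : exists f2 : kos A^o [seq x j | j <- js],
    (if i is i'.+1 then khom i' f2 else f2 = 0) /\ kphi f2 = h2.
  case: i hh {hf1} => [|i] hh.
    exists 0; rewrite linear0; split=> //; apply/ffunP => T; rewrite [LHS]ffunE.
    apply/esym/eqP; apply: contraT => /h2s[jT /hh].
    by rewrite cardsU1 jT.
  have [||f2 hf2] := IH i h2 hu; last by exists f2.
  - by move=> T /h2s[jT /hh]; rewrite cardsU1 jT => -[].
  - move=> T /h2s[jT /hs hT] k kT; move: (hT k).
    rewrite !inE kT orbT => /(_ isT) /orP[/eqP ej|//].
    by rewrite -ej kT in jT.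
exists (f1, f2); split; first by split.
rewrite /= ef1 ef2; apply/ffunP => T; rewrite !ffunE.
case: ifPn => jT; last by rewrite addr0.
by rewrite !inE eqxx add0r finset.setD1K.
Qed.

Lemma kphi_homogeneous js i f : uniq js -> khom i f -> homogeneous i (@kphi js f).
Proof.
move=> hu hf; apply/homogeneousP; elim: js hu i f hf => [|j js IH] hu i f /=.
  move=> hf T; rewrite ffunE; case: ifP => [/eqP ->|]; rewrite ?eqxx // cards0.
  by case: i hf => // i ->; rewrite eqxx.
move: hu => /= /andP[jjs hu].
case: f => f1 f2 /= [hf1 hf2] T; rewrite !ffunE => hT.
have [h1|h1] := eqVneq (kphi f1 T) 0; last exact: IH h1.
move: hT; rewrite h1 add0r; case: ifP => [jT|]; last by rewrite eqxx.
case: i hf2 {hf1} => [->|i hf2 hT]; first by rewrite linear0 ffunE eqxx.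
by rewrite (cardsD1 j) jT (IH hu i f2 hf2).
Qed.

End Comparison.

(** * Cycles, boundaries and homology *)

Section KoszulModules.
Variables (A : comNzRingType) (n : nat) (x : 'I_n -> A).
Local Notation xs := [seq x j | j <- enum 'I_n].
Implicit Types (i : nat) (h : koszul A n) (T : {set 'I_n}).

Let phi : kos A^o xs -> koszul A n := @kphi A n x (enum 'I_n).

Lemma enum_ord_sorted : sorted (fun i j : 'I_n => (i < j)%N) (enum 'I_n).
Proof. by have := iota_ltn_sorted 0 n; rewrite -val_enum_ord sorted_map. Qed.

Let phi_kd f : koszul_d x (phi f) = phi (kd f).
Proof. exact/kphi_kd/enum_ord_sorted. Qed.

Let phi_inj : injective phi.
Proof. exact/kphi_inj/enum_uniq. Qed.

Let phi_surj i h : homogeneous i h -> exists f, khom i f /\ phi f = h.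
Proof. by move=> hh; apply: kphi_surj (enum_uniq _) hh _ => T _ k _; rewrite mem_enum. Qed.

Let phi_homogeneous i f : khom i f -> homogeneous i (phi f).
Proof. exact/kphi_homogeneous/enum_uniq. Qed.

(** The passage between the recursive complex, where torsion is proved, and the cycles and
    boundaries that define [koszul_homology]. *)
Lemma kos_torsion_boundary (S : A -> Prop) i : kos_torsion S xs i A^o <->
  forall z : submod (koszul_cycle x i), exists2 s, S s & s *: z \in @koszul_boundary A n x i.
Proof.
split=> [hnull [c hc]|hb f hf df].
  have /andP[hhom /eqP dc] := hc.
  have [f [hf ef]] := phi_surj hhom.
  have [|s [g [Ss hg dg]]] := hnull f hf.
    by apply: phi_inj; rewrite -phi_kd ef dc /phi linear0.
  exists s => //; apply/asboolP; exists (phi g); first exact: phi_homogeneous.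
  by rewrite phi_kd dg /phi linearZ /= -/phi ef.
have hc : phi f \in koszul_cycle x i.
  by apply/andP; split; [exact: phi_homogeneous|rewrite phi_kd df /phi linear0].
have [s Ss /asboolP[h hh dh]] := hb (Submod hc).
have [g [hg eg]] := phi_surj hh.
exists s, g; split=> //; apply: phi_inj.
by rewrite -phi_kd eg dh GRing.valZ /phi linearZ.
Qed.

Lemma seq_mul_boundary (a : A) i (z : submod (koszul_cycle x i)) :
  @seq_mul A A^o xs a -> a *: z \in @koszul_boundary A n x i.
Proof.
(* With S reduced to a, torsion says that a itself carries cycles to boundaries, which the homotopy
   provides. *)
move=> [u ea]; have [|s ->] := proj1 (kos_torsion_boundary (fun s => s = a) i) _ z; last by [].
move=> f hf df; exists a, (kwedge u f); split=> //; first exact: khom_kwedge.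
by rewrite ea -[LHS]addr0 -(linear0 (@kwedge A A^o xs u)) -df kwedge_homotopy.
Qed.

Lemma homogeneous_koszul_d i h : homogeneous i.+1 h -> homogeneous i (koszul_d x h).
Proof.
move=> /phi_surj[f [hf <-]]; rewrite phi_kd.
exact/phi_homogeneous/khom_kd.
Qed.

Lemma homogeneous_gt h i : (n < i)%N -> homogeneous i h -> h = 0.
Proof.
move=> hi /phi_surj[f [hf <-]]; rewrite (khom_gt_size _ hf) /phi ?linear0 //.
by rewrite size_map size_enum_ord.
Qed.

Lemma homogeneous0_koszul_d h : homogeneous 0 h -> koszul_d x h = 0.
Proof. by move=> /phi_surj[f [hf <-]]; rewrite phi_kd kd_khom0 // /phi linear0. Qed.

Definition homog i : {pred koszul A n} := fun h => homogeneous i h.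

Lemma homog_submod i : submod_closed (homog i).
Proof.
split; first exact: homogeneous0.
by move=> a f g; exact: homogeneous_lin.
Qed.
HB.instance Definition _ i :=
  GRing.isSubmodClosed.Build A (koszul A n) (homog i) (homog_submod i).

Lemma val_linear (V : lmodType A) (W : submodClosed V) :
  linear (fun w : submod W => val w).
Proof. by move=> a u v; rewrite GRing.valD GRing.valZ. Qed.

Hypothesis hA : noetherian A.

Definition kdelta (T : {set 'I_n}) (a : A) : koszul A n :=
  [ffun S : {set 'I_n} => if S == T then a else 0].

Lemma kdelta_linear T : linear (fun a : A^o => kdelta T a).
Proof.
move=> a u v; apply/ffunP => S; rewrite !ffunE; case: ifP => // _.
by rewrite scaler0 addr0.
Qed.

Lemma kdelta_sum h : h = \sum_T kdelta T (h T).
Proof.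
apply/ffunP => S; rewrite sum_ffunE (bigD1 S) //= ffunE eqxx big1 ?addr0 // => T.
by rewrite ffunE eq_sym => /negPf ->.
Qed.

Lemma kdelta_homogeneous T a : homogeneous #|T| (kdelta T a).
Proof.
by apply/homogeneousP => S; rewrite ffunE; case: ifP => [/eqP ->|]; rewrite ?eqxx.
Qed.

Lemma noeth_mod_koszul : noeth_mod (koszul A n).
Proof.
apply: (@noeth_mod_surj _ (kos A^o xs) _ (@kphi A n x (enum 'I_n))); last first.
  exact/noeth_mod_kos/noeth_mod_ring.
move=> w; rewrite [w]kdelta_sum.
apply: (big_ind (fun w => exists v, w = kphi v)).
- by exists 0; rewrite linear0.
- by move=> _ _ [u ->] [v ->]; exists (u + v); rewrite linearD.
- move=> T _; have [f [_ <-]] := phi_surj (kdelta_homogeneous T (w T)).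
  by exists f.
Qed.

Lemma noeth_mod_submod (W : submodClosed (koszul A n)) : noeth_mod (submod W).
Proof.
apply: (@noeth_mod_inj _ _ _ (mklin (@val_linear _ W))) noeth_mod_koszul.
exact: val_inj.
Qed.

Lemma cycle_homog i (z : submod (koszul_cycle x i)) : val z \in homog i.
Proof. by case: z => c /= /andP[]. Qed.

Definition cycle_incl i (z : submod (koszul_cycle x i)) : submod (homog i) :=
  Submod (cycle_homog z).

Lemma cycle_incl_linear i : linear (@cycle_incl i).
Proof. by move=> a u v; apply: val_inj. Qed.

Lemma koszul_d_cycle i (k : submod (homog i.+1)) :
  koszul_d x (val k) \in koszul_cycle x i.
Proof.
by case: k => h hh; apply/andP; split; [exact: homogeneous_koszul_d|rewrite koszul_dd].
Qed.

Lemma koszul_d_boundary i (k : submod (homog i.+1)) :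
  Submod (koszul_d_cycle k) \in @koszul_boundary A n x i.
Proof. by apply/asboolP; exists (val k) => //; case: k. Qed.

Definition boundary_map i (k : submod (homog i.+1)) :
  submod (@koszul_boundary A n x i) := Submod (koszul_d_boundary k).

Lemma boundary_map_linear i : linear (@boundary_map i).
Proof.
move=> a u v; do 2!apply: val_inj.
transitivity (koszul_d x (val (a *: u + v))) => //.
by rewrite !GRing.valD !GRing.valZ linearP.
Qed.

Lemma boundary_map_surj i b : exists k, @boundary_map i k = b.
Proof.
have /asboolP[f hf df] : val b \in @koszul_boundary A n x i by case: b.
have hf' : f \in homog i.+1 by [].
by exists (Submod hf'); do 2!apply: val_inj.
Qed.

Lemma boundary_map_ker i k : boundary_map k = 0 -> exists z, @cycle_incl i.+1 z = k.
Proof.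
move=> /(congr1 (fun b => val (val b))) /= dk.
have hk : val k \in koszul_cycle x i.+1.
  by apply/andP; split; [case: (k)|rewrite dk].
by exists (Submod hk); apply: val_inj.
Qed.

Lemma boundary_map_cycle i z : boundary_map (@cycle_incl i.+1 z) = 0.
Proof.
by do 2!apply: val_inj; case: z => c /= hc; case/andP: (hc) => _ /eqP.
Qed.

Lemma boundary_eq0 i (b : submod (@koszul_boundary A n x i)) : (n <= i)%N -> b = 0.
Proof.
move=> hi; have [k <-] := boundary_map_surj b; do 2!apply: val_inj => /=.
rewrite (@homogeneous_gt (val k) i.+1) ?linear0 //.
by case: k.
Qed.

Lemma homology_pi i : exists pi : {linear submod (koszul_cycle x i) -> koszul_homology x i},
  (forall q, exists e, pi e = q) /\ (forall e, pi e = 0 <-> e \in @koszul_boundary A n x i).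
Proof. exact: quotmod_pi. Qed.

Lemma noeth_mod_homology i : noeth_mod (koszul_homology x i).
Proof.
have [pi [surj _]] := homology_pi i.
apply: (@noeth_mod_surj _ _ _ pi); last exact: noeth_mod_submod.
by move=> w; have [v <-] := surj w; exists v.
Qed.

End KoszulModules.

(** * The theorem *)

Section DepthTransfer.
Variables (A : comNzRingType) (z : seq A).
Implicit Types E U V : lmodType A.

Lemma depth_ge0 E : depth_ge z 0 E.
Proof. by move=> j hj; apply: kos_torsion_gt_size => //; lia. Qed.

Lemma depth_ge_zero k E : (forall e : E, e = 0) -> depth_ge z k E.
Proof.
move=> h0 j hj f hf df.
have -> : f = 0.
  elim: z f {hj hf df} => [|a l IH] f; first exact: h0.
  by case: f => f1 f2 /=; rewrite (IH f1) (IH f2).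
by exists 1, 0; rewrite linear0 scaler0; split=> //; exact: subm0 (khom_subm _ _ _).
Qed.

Lemma depth_ge_bij k U V (phi : {linear U -> V}) : injective phi ->
  (forall v, exists u, phi u = v) -> depth_ge z k U -> depth_ge z k V.
Proof.
move=> inj surj hU j hj f hf df.
have [u [hu eu]] := kmap_lift surj hf; subst f.
have [|s [g [-> hg dg]]] := hU j hj u hu.
  by apply: (kmap_inj inj); rewrite kmap_kd df linear0.
exists 1, (kmap phi g); split=> //; first exact: kmap_khom.
by rewrite -kmap_kd dg linearZ.
Qed.

(** W is described by its members so as to cover both K_i and Z_0, which is all of K_0. *)
Lemma depth_ge_homogeneous n i k (W : submodClosed (koszul A n)) :
  (forall h, (h \in W) = homogeneous i h) -> depth_ge z k A^o -> depth_ge z k (submod W).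
Proof.
move=> hW hk j /hk; pose T := {set 'I_n}.
have hi (S : T) (a : A) : kdelta S (if #|S| == i then a else 0) \in W.
  rewrite hW; case: eqP => [<-|_]; first exact: kdelta_homogeneous.
  have -> : @kdelta A n S 0 = 0 := linear0 (mklin (@kdelta_linear A n S)).
  exact: homogeneous0.
pose iota (S : T) (a : A^o) : submod W := Submod (hi S a).
have iotal S : linear (iota S).
  move=> a u v; apply: val_inj; rewrite GRing.valD GRing.valZ /=.
  rewrite -(kdelta_linear S a); congr (kdelta S _).
  by case: ifP => // _; rewrite scaler0 addr0.
have pl (S : T) : linear (fun w : submod W => val w S : A^o).
  by move=> a u v; rewrite GRing.valD GRing.valZ !ffunE.
apply: (kos_torsion_retract (iota := fun S => mklin (iotal S)) (p := fun S => mklin (pl S))) => /=.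
move=> w; apply: val_inj; rewrite raddf_sum /= [LHS]kdelta_sum.
apply: eq_bigr => S _; case: eqP => // hS; congr (kdelta S _).
apply/eqP; apply: contraT => wS; case: hS.
have : val w \in W by case: (w).
by rewrite hW => /homogeneousP; apply.
Qed.

End DepthTransfer.

Section Main.
Variables (A : comNzRingType) (M : {pred A}).
Hypotheses (hA : noetherian A) (hM : local_ring M).
Variable z : seq A.
Hypotheses (zM : {subset z <= M}) (Mz : forall a, a \in M -> @seq_mul A A^o z a)
  (zreg : regular_seq A^o z).
Variables (I : {pred A}) (hI : idealr_closed I).
Variables (m : nat) (x : 'I_m -> A) (hx : generates x I).
Variable y : seq A.
Hypothesis hy : maximal_regular_seq A^o I y.
Local Notation xs := [seq x j | j <- enum 'I_m].
Local Notation d := (size z).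
Local Notation g := (size y).

Let IM : {subset I <= M}.
Proof.
apply: (proper_sub_maximal hA hM (idealr_subm hI)).
by apply/negP; case: hI.
Qed.

Let yI : {subset y <= I}. Proof. by case: hy. Qed.
Let yreg : regular_seq A^o y. Proof. by case: hy. Qed.

Let Ixs a : a \in I -> @seq_mul A A^o xs a.
Proof. by move=> /hx ha; exact/seq_mul_codom. Qed.

Let xsI : {subset xs <= I}.
Proof.
move=> _ /mapP[i _ ->]; apply/hx; exists (fun j => (j == i)%:R).
by rewrite (bigD1 i) //= eqxx mul1r big1 ?addr0 // => j /negPf ->; rewrite mul0r.
Qed.

Let A_depth_ge : depth_ge z d A^o.
Proof. exact: (regular_depth_ge Mz zreg zM). Qed.

Let noethA : noeth_mod A^o := noeth_mod_ring hA.

Lemma ass_prime_over : exists P b, [/\ prime_ideal P, {subset I <= P},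
  ~ @seq_mul A A^o y b & P = to_pred (fun a => @seq_mul A A^o y (a *: (b : A^o)))].
Proof.
have [|e ne he] := zero_divisors_common hA noethA (seq_mul_subm A^o y) (idealr_subm hI).
  by move=> a; exact: (maximal_zero_divisor hA hM noethA IM hy).
have [b [nb eb hP _]] := ass_prime hA (seq_mul_subm A^o y) ne.
exists (to_pred (fun a => @seq_mul A A^o y (a *: (b : A^o)))), b; split=> //.
by move=> a /he/eb h; apply/prP.
Qed.

Lemma kos_torsion_ge j : (m < j + g)%N -> kos_torsion (fun t => t = 1) xs j A^o.
Proof.
move=> hj; apply: (regular_null (s := y)) => //.
  by move=> a /yI/Ixs/seq_mul_sum.
by rewrite size_map size_enum_ord.
Qed.

(** * Dimension and depth of the Koszul homology *)

Section AssociatedPrime.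
Variables (P : {pred A}) (b : A).
Hypotheses (hP : prime_ideal P) (IP : {subset I <= P})
  (nb : ~ @seq_mul A A^o y b)
  (eP : P = to_pred (fun a => @seq_mul A A^o y (a *: (b : A^o)))).

(** Rigidity carries torsion up to all degrees from m - g on; [kos_torsion_regular_top] then
    produces t outside P with t b in (y), against P = (y : b). *)
Lemma not_null i : (i <= m - g)%N -> ~ kos_torsion (fun s => s \notin P) xs i A^o.
Proof.
move=> hi hnull.
have up j : (i <= j)%N -> kos_torsion (fun s => s \notin P) xs j A^o.
  move=> /subnK <-; elim: (j - i)%N => // k IH; rewrite addSn.
  by apply: kos_torsion_rigid IH => // a /xsI/IP.
have [||||| t [tP ht]] := @kos_torsion_regular_top _ xs (fun s => s \notin P) A^o y b.
- exact: prime1.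
- by move=> s t; exact: primeM.
- exact: yreg.
- by move=> j; rewrite size_map size_enum_ord => hj; apply: up; lia.
- by move=> a /xsI/IP; rewrite eP => /prP.
by move/negP: tP; apply; rewrite eP; apply/prP.
Qed.

(** For m < g the sequence y would kill H_0, while [not_null] applies to it because the truncated m
    - g is 0. *)
Lemma grade_le : (g <= m)%N.
Proof.
rewrite leqNgt; apply/negP => lt; apply: (@not_null 0%N) => // f hf df.
have [|s [h [-> hh dh]]] := @kos_torsion_ge 0%N _ f hf df; first by [].
by exists 1, h; split=> //; exact: prime1.
Qed.

Lemma annihilator_sub i : (i <= m - g)%N ->
  {subset annihilator (koszul_homology x i) <= P}.
Proof.
move=> hi a /asboolP ha; apply: contrapT => /negP aP.
apply: (not_null hi); apply/kos_torsion_boundary => c; exists a => //.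
have [pi [_ ker]] := homology_pi x i.
by apply/ker; rewrite linearZ /= ha.
Qed.

Lemma homology_neq0 i : (i <= m - g)%N -> exists e : koszul_homology x i, e <> 0.
Proof.
move=> hi; apply: contrapT => h.
have /negP := prime1 hP; apply; apply: (annihilator_sub hi).
apply/asboolP => e; rewrite scale1r; apply: contrapT => ne.
by apply: h; exists e.
Qed.

(** As depth A >= d, a maximal regular sequence in M prolonging y has at least d - g entries after
    y, and each of them adds a step above P. *)
Lemma chain_over : exists p, prime_chain (d - g) p /\ p 0%N = P.
Proof.
have yM : {subset y <= M} by move=> a /yI/IM.
have [w hw] := regular_maximal hA hM zM Mz noethA (fun _ => id) yreg yM.
have := depth_ge_maximal_regular hA hM zM noethA hw A_depth_ge; rewrite size_cat => hd.
have [wM wreg _] := hw.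
have ty : take g (y ++ w) = y by rewrite take_size_cat.
have := @regular_chain _ hA M hM A^o (y ++ w) g (d - g) b noethA wreg wM.
rewrite ty size_cat -eP; apply => //; lia.
Qed.

Lemma homology_dim_ge i : (i <= m - g)%N ->
  (d - g <= module_dim (koszul_homology x i))%N.
Proof.
move=> hi; have [p [hp p0]] := chain_over.
apply: (krull_dim_ge hA hM zM Mz); exists p; split=> //.
by rewrite p0; exact: annihilator_sub.
Qed.

Lemma grade_le_dim : (g <= d)%N.
Proof. by apply: (regular_size_bound hA hM zM Mz noethA yreg) => a /yI/IM. Qed.

Lemma homology_dim_le i : (module_dim (koszul_homology x i) <= d - g)%N.
Proof.
apply: (krull_dim_le hA hM zM Mz) => k [p [hp sp]].
(* Primes above the annihilator contain I, hence y, so the chain can be prolonged downwards by g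
   steps and is still bounded by d. *)
have [|q hq] := chain_below_regular hA yreg hp.
  move=> a; apply: (seq_mul_mem (prime_subm (proj1 hp _ (leq0n _)))) => c f /yI cI.
  rewrite [_ *: _]mulrC; apply: (prime_absorb (proj1 hp _ (leq0n _))); apply: sp.
  apply/asboolP => e; have [pi [surj ker]] := homology_pi x i.
  have [v <-] := surj e; rewrite -linearZ_LR; apply/ker.
  exact/seq_mul_boundary/Ixs.
by have := chain_le hA hM zM Mz hq; lia.
Qed.

Local Notation Z i := (submod (koszul_cycle x i)).
Local Notation B i := (submod (@koszul_boundary A m x i)).
Local Notation H i := (koszul_homology x i).

Lemma homog_depth_ge i : depth_ge z d (submod (@homog A m i)).
Proof. by apply: (@depth_ge_homogeneous A z m i) => // h. Qed.

Lemma boundary_depth_ge k i : depth_ge z k.+1 (Z i) -> depth_ge z k (H i) -> depth_ge z k.+1 (B i).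
Proof.
have [pi [surj ker]] := homology_pi x i.
apply: (@depth_ge_sub A z k (B i) (Z i) (H i)
  (mklin (@val_linear _ _ (@koszul_boundary A m x i))) pi) => //=.
- exact: val_inj.
- by move=> v /ker hv; exists (Submod hv).
- by move=> [v hv] /=; apply/ker.
Qed.

Lemma cycle_depth_ge k i : (k < d)%N -> depth_ge z k (B i) -> depth_ge z k.+1 (Z i.+1).
Proof.
move=> hk; apply: (@depth_ge_sub A z k (Z i.+1) (submod (homog i.+1)) (B i)
  (mklin (@cycle_incl_linear A m x i.+1)) (mklin (@boundary_map_linear A m x i))) => /=.
- by move=> u v /(congr1 val) /= /val_inj.
- exact: boundary_map_surj.
- by move=> v /boundary_map_ker.
- exact: boundary_map_cycle.
- exact: depth_geW hk (@homog_depth_ge i.+1).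
Qed.

Lemma boundary_depth_ge_down k i : (k <= d)%N -> depth_ge z k.+1 (Z i.+1) -> depth_ge z k (B i).
Proof.
move=> hk hZ; apply: (@depth_ge_quot A z k (Z i.+1) (submod (homog i.+1)) (B i)
  (mklin (@cycle_incl_linear A m x i.+1)) (mklin (@boundary_map_linear A m x i))) => //=.
- by move=> u v /(congr1 val) /= /val_inj.
- exact: boundary_map_surj.
- by move=> v /boundary_map_ker.
- exact: boundary_map_cycle.
- exact: depth_geW hk (@homog_depth_ge i.+1).
Qed.

Lemma homology_depth_ge k i : depth_ge z k.+1 (B i) -> depth_ge z k (Z i) -> depth_ge z k (H i).
Proof.
have [pi [surj ker]] := homology_pi x i.
apply: (@depth_ge_quot A z k (B i) (Z i) (H i)
  (mklin (@val_linear _ _ (@koszul_boundary A m x i))) pi) => //=.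
- exact: val_inj.
- by move=> v /ker hv; exists (Submod hv).
- by move=> [v hv] /=; apply/ker.
Qed.

(** Above degree m - g cycles are boundaries, so a step down is 0 -> B_{i+1} -> K_{i+1} -> B_i -> 0
    and costs one. B_m = 0 has every depth; d + 1 is the largest start for which the depth d of K_m
    still suffices in the first step. *)
Lemma top_boundary_depth_ge j : (j <= g)%N -> depth_ge z (d - j).+1 (B (m - j)).
Proof.
have gm := grade_le; have gd := grade_le_dim.
elim: j => [_|j IH hj].
  by apply: depth_ge_zero => e; apply: boundary_eq0; rewrite subn0.
have ej : (m - j = (m - j.+1).+1)%N by lia.
have ek : (d - j = (d - j.+1).+1)%N by lia.
have := IH (ltnW hj); rewrite ej ek => hB.
apply: boundary_depth_ge_down; first lia.
apply: (@depth_ge_bij A z _ (B _) (Z _)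
  (mklin (@val_linear _ _ (@koszul_boundary A m x (m - j.+1).+1)))) hB => /=.
  exact: val_inj.
move=> c; have hn : kos_torsion (fun t => t = 1) xs (m - j.+1).+1 A^o by apply: kos_torsion_ge; lia.
have [s -> hc] := proj1 (kos_torsion_boundary _ _ _) hn c.
by rewrite scale1r in hc; exists (Submod hc).
Qed.

Lemma top_homology_depth_ge k : (forall i, (i < m - g)%N -> depth_ge z k (H i)) ->
  depth_ge z (minn (d - g) k.+2) (H (m - g)).
Proof.
move=> hk; have gm := grade_le; have gd := grade_le_dim.
have hZ i : (i <= m - g)%N -> depth_ge z (minn d k.+2) (Z i).
  elim: i => [_|i IH hi].
    apply: (@depth_ge_homogeneous A z m 0); last exact: depth_geW (geq_minl _ _) A_depth_ge.
    move=> h; apply/andP/idP => [[]//|hh]; split=> //.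
    by rewrite homogeneous0_koszul_d.
  have := IH (ltnW hi); case e : (minn d k.+2) => [|e1] hZi; first exact: depth_ge0.
  apply: cycle_depth_ge; first lia.
  case: e1 e hZi => [|e2] e hZi; first exact: depth_ge0.
  apply: boundary_depth_ge; first exact: depth_geW hZi.
  by apply: depth_geW (hk i hi); lia.
apply: homology_depth_ge.
  by apply: depth_geW (top_boundary_depth_ge (leqnn _)); lia.
by apply: depth_geW (hZ _ (leqnn _)); lia.
Qed.

Lemma top_cmd (c : nat) :
  (forall i, (i < m - g)%N -> cmd (H i) M <= c%:Z) ->
  cmd (H (m - g)) M <= Num.max 0 (c%:Z - 2).
Proof.
move=> hc.
(* The truncated difference is harmless: for c > d - g the final bound max(0, d - g - 2) is at most
   max(0, c - 2). *)
have hk i : (i < m - g)%N -> depth_ge z (d - g - c) (H i).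
  move=> hi; have ne := homology_neq0 (ltnW hi).
  have := hc i hi; have := homology_dim_ge (ltnW hi).
  have := depth_ge_depth hA hM zM Mz (noeth_mod_homology hA (x := x) (i := i)) ne.
  rewrite /cmd => hd h1 h2; apply: depth_geW hd; lia.
have := top_homology_depth_ge hk.
move=> /(depth_ge_le_depth hA hM zM Mz (noeth_mod_homology hA (x := x) (i := m - g))
  (homology_neq0 (leqnn _))).
have := homology_dim_le (m - g); rewrite /cmd; lia.
Qed.

End AssociatedPrime.
End Main.

Theorem theorem1p9 (A : comNzRingType) (M : {pred A})
    (hA : regular_local_ring M) (I : {pred A}) (hI : idealr_closed I)
    (x : 'I_(mu I) -> A) (hx : generates x I) :
  let m := mu I in
  let g := grade A^o I in
  let c := \big[Num.max/0]_(i < m - g) cmd (koszul_homology x i) M in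
  cmd (koszul_homology x (m - g)) M <= Num.max 0 (c - 2).
Proof.
have [hN hM _] := hA; have [z [zM Mz zreg]] := regular_system hA.
have IM : {subset I <= M}.
  apply: (proper_sub_maximal hN hM (idealr_subm hI)).
  by apply/negP; case: hI.
have [|y hy <-] := grade_maximal hN hM zM Mz (noeth_mod_ring hN) IM.
  by exists 1; apply/eqP; exact: oner_neq0.
cbv zeta; set c := \big[_/_]_(i < _) _.
have [P [b [hP IP nb eP]]] := ass_prime_over hN hM hI hy.
(* The seed 0 of the maximum makes c nonnegative, hence a natural number as [top_cmd] expects. *)
have c0 : 0 <= c by exact: bigmax_ge_id.
have ec : c = Posz `|c|%N by rewrite gez0_abs.
rewrite ec; apply: (top_cmd hN hM zM Mz zreg hI hx hy hP IP nb eP) => i hi.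
rewrite -ec.
exact: (le_bigmax _ (fun i : 'I_(mu I - size y) => cmd (koszul_homology x i) M) (Ordinal hi)).
Qed.
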